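(* Let $N\ge 2$, let $\Omega\subset\mathbb{R}^N$ be a bounded smooth domain, let $a>0$, $b>0$, $\alpha>0$ and $1<p<2\alpha+1<2^*$. Let $h:\overline\Omega\times\mathbb{R}\times\mathbb{R}^N\to\mathbb{R}$, $(x,s,\xi)\mapsto h(x,s,\xi)$, satisfy: - for $s>0$, $h(x,s,\xi)$ is Hölder continuous and $h(x,s,\xi)\ge 0$; - there is a constant $\lambda>0$ such that $\lim_{s\to 0^+}\frac{h(x,s,\xi)}{s}=\lambda$ uniformly in $x$ and $\xi$, and there are constants $C>0$ and $q$ with $1<q<p$ such that $|h(x,s,\xi)|\le C(s+s^q)$ for all $s>0$ and all $x,\xi$. Assume moreover that $\lambda<a\lambda_1(\Omega)$. For $t\in[0,1]$ consider the problem $$(P_t)\qquad -(a+tb\|\nabla u\|_2^{2\alpha})\Delta u=u^p+t\,h(x,u,\nabla u)\ \text{ in }\Omega,\qquad u>0\ \text{ in }\Omega,\qquad u=0\ \text{ on }\partial\Omega .$$ Then for every fixed $t_0\in(0,1]$ there exists a positive constant $R$, which may depend on $t_0$, such that for every $t\in[t_0,1]$ every solution $u\in C^2(\Omega)\cap C(\overline\Omega)$ of $(P_t)$ satisfies $\|u\|_{C(\Omega)}\le R$.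
   Context: $\|\nabla u\|_2$ is the $L^2(\Omega)$ norm of $|\nabla u|$ (finite for solutions). $\|u\|_{C(\Omega)}=\sup_{x\in\Omega}|u(x)|$. $\lambda_1(\Omega)$ is the first eigenvalue of $-\Delta$ on $\Omega$ with zero Dirichlet boundary condition. $2^*=+\infty$ if $N=2$ and $2^*=\frac{N+2}{N-2}$ if $N\ge 3$. *)

(* Defs.v *)
From HB Require Import structures.
From mathcomp Require Import all_boot all_order all_algebra.
From mathcomp Require Import all_classical all_reals all_analysis.

Set Implicit Arguments.
Unset Strict Implicit.
Unset Printing Implicit Defensive.

Import Order.TTheory GRing.Theory Num.Theory.
Import numFieldNormedType.Exports.

Local Open Scope classical_set_scope.
Local Open Scope ring_scope.

(* Points of R^N are row vectors.  Their library norm is the sup norm, which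
   is used only where the choice among equivalent norms is immaterial. *)

Section PowerMeasure.
Context d {T : measurableType d} {R : realType}.
Variable nu : {sigma_finite_measure set T -> \bar R}.

Definition tcons n (xt : (T * n.-tuple T)%type) : n.+1.-tuple T :=
  [tuple of xt.1 :: xt.2].

Lemma measurable_tcons n : measurable_fun setT (@tcons n).
Proof. exact: measurable_cons. Qed.

Section Step.
Variables (n : nat) (mu : {sigma_finite_measure set (n.-tuple T) -> \bar R}).

Definition tcons_measure : set (n.+1.-tuple T) -> \bar R :=
  pushforward (nu \x mu)%E (@tcons n).

Let m0 : tcons_measure set0 = 0%E.
Proof. by rewrite /tcons_measure /pushforward preimage_set0 measure0. Qed.

Let m_ge0 A : (0 <= tcons_measure A)%E.
Proof. exact: (measure_ge0 (nu \x mu)%E). Qed.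

Let m_sigma_additive : semi_sigma_additive tcons_measure.
Proof.
move=> F mF tF mUF; rewrite /tcons_measure /pushforward preimage_bigcup.
apply: measure_semi_sigma_additive.
- by move=> k; rewrite -[X in measurable X]setTI; exact: measurable_tcons.
- apply/trivIsetP => /= i j _ _ ij; rewrite -preimage_setI.
  by move/trivIsetP : tF => /(_ _ _ _ _ ij) ->//; rewrite preimage_set0.
- rewrite -preimage_bigcup -[X in measurable X]setTI.
  exact: measurable_tcons.
Qed.

HB.instance Definition _ := isMeasure.Build _ _ _ tcons_measure
  m0 m_ge0 m_sigma_additive.

Let m_sigma_finite : sigma_finite setT tcons_measure.
Proof.
have /sigma_finiteP[F [FT ndF Foo]] := sigma_finiteT nu.
have /sigma_finiteP[G [GT ndG Goo]] := sigma_finiteT mu.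
pose g (t : n.+1.-tuple T) : (T * n.-tuple T)%type :=
  (thead t, [tuple of behead t]).
have mg : measurable_fun setT g.
  apply: measurable_fun_pair; first exact: measurable_tnth.
  exact: measurable_behead.
have gK xt : g (tcons xt) = xt.
  case: xt => x t; rewrite /g /tcons theadE; congr pair.
  exact: val_inj.
exists (fun k => g @^-1` (F k `*` G k)).
  apply/esym/seteqP; split=> // t _.
  have [k _ Fk] : (\bigcup_k F k) (g t).1 by rewrite -FT.
  have [l _ Gl] : (\bigcup_k G k) (g t).2 by rewrite -GT.
  exists (maxn k l) => //; split.
    by move: Fk; exact/subsetPset/ndF/leq_maxl.
  by move: Gl; exact/subsetPset/ndG/leq_maxr.
move=> k; have [mFk Fk] := Foo k; have [mGk Gk] := Goo k; split.
  by rewrite -[X in measurable X]setTI; apply: mg => //; exact: measurableX.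
rewrite /tcons_measure /pushforward.
rewrite (_ : _ @^-1` _ = F k `*` G k); last first.
  by apply/funext => xt; rewrite -[RHS](congr1 (F k `*` G k) (gK xt)).
by rewrite product_measure1E// lte_mul_pinfty// ge0_fin_numE.
Qed.

HB.instance Definition _ := Measure_isSigmaFinite.Build _ _ _
  tcons_measure m_sigma_finite.

End Step.

(* n-fold product of nu; for n = 0, the unit mass on the empty tuple. *)
Fixpoint power_measure n : {sigma_finite_measure set (n.-tuple T) -> \bar R} :=
  match n with
  | 0%N => [the {sigma_finite_measure set (0.-tuple T) -> \bar R} of
              dirac [tuple]]
  | m.+1 => [the {sigma_finite_measure set (m.+1.-tuple T) -> \bar R} of
              tcons_measure (power_measure m)]
  end.

End PowerMeasure.

Definition lebesgueN (R : realType) (n : nat) :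
    {sigma_finite_measure set (n.-tuple (measurableTypeR R)) -> \bar R} :=
  power_measure (@lebesgue_measure R) n.

Definition row_of_tuple (R : realType) n (t : n.-tuple (measurableTypeR R)) :
  'rV[R]_n := \row_i tnth t i.

Section Calculus.
Context {R : realType} {N : nat}.
Implicit Types (f u : 'rV[R]_N -> R) (A : set 'rV[R]_N).

Definition partial (i : 'I_N) f (x : 'rV[R]_N) : R := 'D_(delta_mx 0 i) f x.

Definition grad f (x : 'rV[R]_N) : 'rV[R]_N := \row_i partial i f x.

Definition laplacian f (x : 'rV[R]_N) : R :=
  \sum_(i < N) partial i (partial i f) x.

Definition enorm (v : 'rV[R]_N) : R := Num.sqrt (\sum_(i < N) v 0 i ^+ 2).

(* f is of class C^k on A; to be used with A open, since continuity and
   derivability are those of f on the whole space. *)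
Fixpoint class_C (k : nat) A f : Prop :=
  (forall x, A x -> {for x, continuous f}) /\
  match k with
  | 0%N => True
  | m.+1 => forall i, (forall x, A x -> derivable f x (delta_mx 0 i)) /\
                      class_C m A (partial i f)
  end.

Definition L2norm_grad (Omega : set 'rV[R]_N) u : \bar R :=
  ('N[lebesgueN R N]_2%:E [
     (fun t => (enorm (grad u (row_of_tuple t)))%:E)
       \_ [set t | Omega (row_of_tuple t)] ])%E.

Definition supnorm (Omega : set 'rV[R]_N) u : \bar R :=
  ereal_sup [set `|u x|%:E | x in Omega].

Definition bdry (Omega : set 'rV[R]_N) : set 'rV[R]_N :=
  closure Omega `\` interior Omega.

Definition dirichlet_eigenvalue (Omega : set 'rV[R]_N) : set R :=
  [set mu | exists phi : 'rV[R]_N -> R,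
    [/\ class_C 2 Omega phi, {within closure Omega, continuous phi},
        (exists2 x, Omega x & phi x != 0),
        (forall x, Omega x -> - laplacian phi x = mu * phi x) &
        (forall x, bdry Omega x -> phi x = 0)]].

Definition lambda1 (Omega : set 'rV[R]_N) : R :=
  inf (dirichlet_eigenvalue Omega).

End Calculus.

(* The boundary is C^oo: near each of its points, after relabelling and
   reorienting the coordinate axes (choice of i and of the side), Omega is the
   strict epigraph of a C^oo function of the N - 1 other coordinates. *)
Definition smooth_boundary (R : realType) (N : nat) (Omega : set 'rV[R]_N) :=
  forall x0, bdry Omega x0 ->
  exists (r : R) (i : 'I_N) (gamma : 'rV[R]_N.-1 -> R),
    [/\ 0 < r, (forall k, class_C k setT gamma) &
        Omega `&` ball x0 r
          = [set x : 'rV[R]_N | gamma (col' i x) < x 0 i] `&` ball x0 r \/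
        Omega `&` ball x0 r
          = [set x : 'rV[R]_N | x 0 i < gamma (col' i x)] `&` ball x0 r].

Definition bounded_smooth_domain (R : realType) (N : nat)
    (Omega : set 'rV[R]_N) : Prop :=
  [/\ open Omega, connected Omega, Omega !=set0, bounded_set Omega &
      smooth_boundary Omega].

(* Hoelder continuity on compact subsets of D: a uniform Hoelder condition on
   an unbounded D would exclude superlinear growth. *)
Definition locally_holder (R : realType) (V : normedModType R) (D : set V)
    (f : V -> R) : Prop :=
  forall K, compact K -> K `<=` D ->
  exists g C : R, [/\ 0 < g, g <= 1 &
    forall x y, K x -> K y -> `|f x - f y| <= C * `|x - y| `^ g].

(* The exponent (N + 2) / (N - 2), not the Sobolev exponent 2N / (N - 2). *)
Definition crit_exponent (R : realType) (N : nat) : \bar R :=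
  if (N <= 2)%N then +oo%E else ((N%:R + 2) / (N%:R - 2))%:E.

(* The equation is an identity in \bar R because the L^2 norm is; as its right
   member is finite and positive, and t * b > 0 unless t = 0, it forces the
   norm to be finite when t > 0. *)
Definition kirchhoff_solution (R : realType) (N : nat) (Omega : set 'rV[R]_N)
    (a b alpha p : R) (h : 'rV[R]_N -> R -> 'rV[R]_N -> R) (t : R)
    (u : 'rV[R]_N -> R) : Prop :=
  [/\ class_C 2 Omega u, {within closure Omega, continuous u},
      (forall x, Omega x ->
         ((a%:E + (t * b)%:E * poweR (L2norm_grad Omega u) (2 * alpha))
            * (- laplacian u x)%:E
          = (u x `^ p + t * h x (u x) (grad u x))%:E)%E),
      (forall x, Omega x -> 0 < u x) &
      (forall x, bdry Omega x -> u x = 0)].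

(* Main.v *)
Require Import Defs.
From HB Require Import structures.
From mathcomp Require Import all_boot all_order all_algebra.
From mathcomp Require Import all_classical all_reals all_analysis.
From mathcomp Require Import measurable_realfun ring lra.
Import Order.TTheory GRing.Theory Num.Theory.
Import numFieldNormedType.Exports.
Local Open Scope classical_set_scope.
Local Open Scope ring_scope.

(** Let m = u x0 be the maximum of a solution, G the square of its Dirichlet
    norm and M = a + t b G^alpha, so that -Delta u <= L with L of order m^p / M.
    The function v = ((u - m/2)_+)^3, extended by 0, is of class C^2 with compact
    support on the whole of R^N, Delta v >= -(3/4) m^2 L, and its Dirichlet
    energy is at most a multiple of m^4 G.

    The average F(s) of y |-> v (x0 + s y) against a radial kernel satisfies
    F' >= - const s m^2 L, because the Laplacian of v is bounded below, and
    |F'| <= const s^(-N/2) |grad v|_2 by Cauchy-Schwarz; F(0) is of order m^3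
    while F is small at a scale s2 comparable with the diameter of Omega.
    Hence F stays large up to the scale s1 with s1^2 of order m / L, and has to
    drop between s1 and s2, which yields s1 <= s2 and
    G >= const m^2 s1^kappa for every kappa > 0 with kappa >= N - 2.

    Since M >= t0 b G^alpha, s1^2 = const M m^(1-p) is at least
    const m^(2 alpha + 1 - p) s1^(alpha kappa).  The growth restriction on alpha
    allows alpha kappa < 2, and then s1 <= s2 bounds m. *)

Set Implicit Arguments.
Unset Strict Implicit.
Unset Printing Implicit Defensive.

(** * Affine changes of variables for Lebesgue measure on R^n *)

Lemma measurable_affine (R : realType) (c s : R) :
  measurable_fun setT (fun x : measurableTypeR R => c + s * x : measurableTypeR R).
Proof.
apply: measurable_funD; first exact: measurable_cst.
by apply: measurable_funM => //; exact: measurable_cst.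
Qed.

(** The push-forward of Lebesgue measure under x |-> c + s x, multiplied by s, gives half-open
    intervals their length, and Lebesgue measure is unique with this property. *)
Lemma lebesgue_measure_affine (R : realType) (c s : R) (A : set (measurableTypeR R)) :
  0 < s -> measurable A ->
  lebesgue_measure [set x | A (c + s * x)] = ((s^-1)%:E * lebesgue_measure A)%E.
Proof.
move=> s0 mA.
have s1 : 0 <= s by exact: ltW.
pose phi (x : measurableTypeR R) : measurableTypeR R := c + s * x.
have m0 : measurable_fun setT phi by exact: measurable_affine.
pose pu := measure_function_pushforward__canonical__measure_function_Measure
  (@lebesgue_measure R) m0.
pose nu := mscale (NngNum s1) pu.
have key : lebesgue_measure A = nu A.
  apply: lebesgue_measure_unique => //= _ [[x y]] _ <-.
  rewrite /nu /mscale /= /pushforward /=.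
  have -> : phi @^-1` [set` `]x, y]] = [set` `](x - c) / s, (y - c) / s]].
    apply/seteqP; split => z /=; rewrite !in_itv/= ltr_pdivrMr// ler_pdivlMr// ltrBlDl lerBrDl [z * s]mulrC//.
  rewrite !lebesgue_measure_itv/= !lte_fin ltr_pM2r ?invr_gt0// ltrD2r.
  case: ifPn => _; last by rewrite mule0.
  by rewrite -!EFinB -EFinM; congr EFin; field; rewrite gt_eqF.
rewrite key /nu /mscale /= muleA -EFinM mulVf ?mul1e//.
by rewrite gt_eqF.
Qed.

Lemma ge0_integral_affine (R : realType) (c s : R) (f : measurableTypeR R -> \bar R) :
  0 < s -> measurable_fun setT f -> (forall x, (0 <= f x)%E) ->
  (\int[@lebesgue_measure R]_x f ((c + s * x)%R) =
   (s^-1)%:E * \int[@lebesgue_measure R]_x f x)%E.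
Proof.
move=> s0 mf f0.
have si : 0 <= s^-1 by rewrite invr_ge0 ltW.
pose phi (x : measurableTypeR R) : measurableTypeR R := c + s * x.
have m0 : measurable_fun setT phi by exact: measurable_affine.
transitivity (\int[pushforward (@lebesgue_measure R) phi]_x f x)%E.
  by rewrite ge0_integral_pushforward.
rewrite -(ge0_integral_mscale _ measurableT (NngNum si))//.
apply: eq_measure_integral => A mA _.
by rewrite /mscale /pushforward /=; exact: lebesgue_measure_affine.
Qed.

Section Tuples.
Context {R : realType}.
Local Notation RT := (measurableTypeR R).

Definition tuple_affine n (c : n.-tuple RT) (s : R) (t : n.-tuple RT) : n.-tuple RT :=
  [tuple (tnth c i + s * tnth t i : RT) | i < n].

Lemma measurable_tuple_affine n (c : n.-tuple RT) (s : R) :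
  measurable_fun setT (tuple_affine c s).
Proof.
apply/measurable_fun_tnthP => i.
rewrite (_ : _ \o _ = (fun x : RT => tnth c i + s * x : RT) \o (fun t => tnth t i)); last first.
  by apply/funext => t; rewrite /= tnth_mktuple.
by apply: measurableT_comp; [exact: measurable_affine|exact: measurable_tnth].
Qed.

Lemma tuple_affine_cons n (c : n.+1.-tuple RT) (s : R) (xt : (RT * n.-tuple RT)%type) :
  tuple_affine c s (tcons xt) =
  tcons (thead c + s * xt.1 : RT, tuple_affine (behead_tuple c) s xt.2).
Proof.
apply: eq_from_tnth => i; rewrite tnth_mktuple.
case: (unliftP ord0 i) => [j|] ->.
  by rewrite !tnthS tnth_mktuple [in LHS](tuple_eta c) tnthS.
by rewrite !tnth0.
Qed.

Lemma ge0_integral_tcons n (f : n.+1.-tuple RT -> \bar R) :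
  measurable_fun setT f -> (forall x, (0 <= f x)%E) ->
  (\int[lebesgueN R n.+1]_t f t =
   \int[@lebesgue_measure R]_x \int[lebesgueN R n]_t f (tcons (x, t)))%E.
Proof.
move=> mf f0.
rewrite /lebesgueN /=.
rewrite ge0_integral_pushforward//; last exact: measurable_tcons.
by rewrite fubini_tonelli1//=; apply: measurableT_comp => //; exact: measurable_tcons.
Qed.

(** Tonelli splits off the first coordinate; each of the n one-dimensional substitutions contributes
    a factor s^-1. *)
Lemma ge0_integral_tuple_affine n (c : n.-tuple RT) (s : R) (f : n.-tuple RT -> \bar R) :
  0 < s -> measurable_fun setT f -> (forall x, (0 <= f x)%E) ->
  (\int[lebesgueN R n]_t f (tuple_affine c s t) =
   (s ^- n)%:E * \int[lebesgueN R n]_t f t)%E.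
Proof.
move=> s0; elim: n c f => [|n IH] c f mf f0.
  rewrite expr0 invr1 mul1e; apply: eq_integral => t _.
  by congr f; rewrite tuple0 [RHS]tuple0.
rewrite !ge0_integral_tcons//; last first.
  by apply: measurableT_comp => //; exact: measurable_tuple_affine.
have mft x : measurable_fun setT (fun t => f (tcons (x, t))).
  apply: measurableT_comp => //; apply: measurableT_comp; [exact: measurable_tcons|exact: pair1_measurable].
have mF : measurable_fun setT (fun x : RT => \int[lebesgueN R n]_t f (tcons (x, t)))%E.
  apply: (@measurable_fun_fubini_tonelli_F _ _ _ _ _ (lebesgueN R n) (fun xt => f (tcons xt))) => //.
  by apply: measurableT_comp => //; exact: measurable_tcons.
under eq_integral => x _.
  under eq_integral do rewrite tuple_affine_cons.
  rewrite (IH _ (fun t => f (tcons (thead c + s * x : RT, t))))//=.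
  over.
have sn : (0 <= (s ^- n)%:E)%E by rewrite lee_fin invr_ge0 exprn_ge0// ltW.
have F0 (x : RT) : (0 <= \int[lebesgueN R n]_t f (tcons (x, t)))%E.
  by apply: integral_ge0.
rewrite ge0_integralZl//; last first.
  by apply: (measurableT_comp mF); exact: measurable_affine.
rewrite (@ge0_integral_affine _ _ _ (fun x : RT => \int[lebesgueN R n]_t f (tcons (x, t)))%E)//.
by rewrite muleA -EFinM -invfM -exprSr.
Qed.

End Tuples.

(** * Borel measurability on row vectors *)

Section RowMeasurability.
Context {R : realType} {n : nat}.
Local Notation RT := (measurableTypeR R).

Lemma mx_ball_coordP (x y : 'rV[R]_n) (e : R) : 0 < e ->
  ball x e y <-> forall i, `|x 0 i - y 0 i| < e.
Proof.
move=> e0; split=> [[_ xy] i|xy]; first exact: xy.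
by split=> // i j; rewrite ord1; exact: xy.
Qed.

(** Tuples carry the product sigma-algebra and rows a topology; a countable union of rational balls
    relates the two. *)
Lemma open_bigcup_rat_ball (U : set 'rV[R]_n) : open U ->
  U = \bigcup_(c in [set c : 'rV[rat]_n * rat |
        0 < c.2 /\ ball (map_mx ratr c.1 : 'rV[R]_n) (ratr c.2) `<=` U])
      ball (map_mx ratr c.1 : 'rV[R]_n) (ratr c.2).
Proof.
move=> oU; apply/seteqP; split=> [x Ux|x [c [_ cU] cx]]; last exact: cU.
have /nbhs_ballP[e /= e0 xeU] : nbhs x U by exact: open_nbhs_nbhs.
(* A rational radius below e / 2, and a centre closer to x than this radius, keep the ball inside
   the ball of radius e about x. *)
have e20 : 0 < e / 2 by rewrite divr_gt0.
have [q /[!in_itv]/= /andP[q0 qe]] := rat_in_itvoo e20.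
have /choice[c cP] : forall i : 'I_n, exists c : rat, `|x 0 i - ratr c| < ratr q.
  move=> i; have xi : x 0 i - ratr q < x 0 i by rewrite ltrBlDr ltrDl.
  have [c /[!in_itv]/= /andP[c1 c2]] := rat_in_itvoo xi.
  by exists c; rewrite ltr_norml; lra.
exists ((\row_i c i), q) => /=.
  split=> [|y /(mx_ball_coordP _ _ q0) cy]; first by rewrite -(ltr0q R).
  apply: xeU; apply/mx_ball_coordP => // i.
  have := cy i; have := cP i; rewrite !mxE !ltr_norml => /andP[? ?] /andP[? ?].
  lra.
by apply/mx_ball_coordP => // i; rewrite !mxE distrC.
Qed.

Lemma measurable_row_of_tuple_preimage (U : set 'rV[R]_n) : open U ->
  measurable (@row_of_tuple R n @^-1` U).
Proof.
move=> oU; rewrite (open_bigcup_rat_ball oU) preimage_bigcup.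
rewrite bigcup_mkcond; apply: countable_bigcupT_measurable => [|[c q]].
  exact: countableP.
case: ifPn => // /[!inE]/= -[q0 _].
(* Balls of the sup norm are cubes, hence finite intersections of conditions on single
   coordinates. *)
rewrite (_ : _ @^-1` _ = \bigcap_(i in [set: 'I_n])
    ((fun t : n.-tuple RT => tnth t i) @^-1` ball (ratr (c 0 i) : R) (ratr q))).
  apply: fin_bigcap_measurable => // i _; rewrite -[X in measurable X]setTI.
  by apply: measurable_tnth => //; exact: measurable_ball.
have q1 : 0 < ratr q :> R by rewrite ltr0q.
apply/seteqP; split=> [t /(mx_ball_coordP _ _ q1) h i _ /=|t h].
  by have := h i; rewrite !mxE.
by apply/mx_ball_coordP => // i; have := h i I; rewrite !mxE.
Qed.

Lemma continuous_row_measurable (f : 'rV[R]_n -> R) : continuous f ->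
  measurable_fun setT (fun t : n.-tuple RT => f (row_of_tuple t)).
Proof.
move=> /continuousP cf.
apply: (measurability _ (RGenOpens.measurableE R)) => _ [_ [a [b ->] <-]].
rewrite setTI.
exact: (measurable_row_of_tuple_preimage (cf _ (interval_open _ _))).
Qed.

End RowMeasurability.

Lemma measurable_cube (R : realType) n (A : set (measurableTypeR R)) :
  measurable A ->
  measurable [set t : n.-tuple (measurableTypeR R) | forall i, A (tnth t i)].
Proof.
move=> mA; rewrite (_ : [set _ | _] = \bigcap_(i in [set: 'I_n])
    ((fun t : n.-tuple (measurableTypeR R) => tnth t i) @^-1` A)); last first.
  by apply/seteqP; split=> t h i; [move=> _; exact: h|exact: (h i)].
apply: fin_bigcap_measurable => // i _; rewrite -[X in measurable X]setTI.
exact: measurable_tnth.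
Qed.

Lemma lebesgueN_cube (R : realType) n (A : set (measurableTypeR R)) (a : R) :
  measurable A -> lebesgue_measure A = a%:E ->
  lebesgueN R n [set t | forall i, A (tnth t i)] = (a ^+ n)%:E.
Proof.
move=> mA Aa; elim: n => [|n IH].
  rewrite expr0 /lebesgueN /= diracE mem_set//= => i; by case: i.
have mC := @measurable_cube R n A mA.
rewrite /lebesgueN /= /tcons_measure /pushforward.
rewrite (_ : _ @^-1` _ = A `*` [set t : n.-tuple (measurableTypeR R) | forall i, A (tnth t i)]).
  rewrite product_measure1E//; move: IH; rewrite /lebesgueN => ->.
  by rewrite [X in (X * _)%E]Aa -EFinM -exprS.
apply/seteqP; split=> [[x t] /= h|[x t] /= [Ax At] i].
  split; first by have := h ord0; rewrite tnth0.
  by move=> i; have := h (lift ord0 i); rewrite tnthS.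
by case: (unliftP ord0 i) => [j|] ->; rewrite ?tnthS ?tnth0.
Qed.

(** * Integration of continuous compactly supported functions *)

Section CompactlySupported.
Context {R : realType} {n : nat}.
Implicit Types (f g : 'rV[R]_n -> R) (x y c : 'rV[R]_n).

Lemma coord_le_norm x (i : 'I_n) : `|x 0 i| <= `|x|.
Proof.
by rewrite [leRHS]/Num.norm /= mx_normrE; apply/bigmax_geP; right; exists (0, i).
Qed.

Definition Cc f := continuous f /\ exists r : R, forall x, r < `|x| -> f x = 0.

Lemma Cc_continuous f : Cc f -> continuous f.
Proof. by case. Qed.
Arguments Cc_continuous {f} _ x.

Lemma Cc_radius f : Cc f -> exists2 r : R, 0 < r & forall x, r <= `|x| -> f x = 0.
Proof.
move=> [_ [r fr]]; exists (Num.max r 0 + 1) => [|x rx].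
  by rewrite ltr_wpDl// le_max lexx orbT.
apply: fr; apply: lt_le_trans rx; apply: (@le_lt_trans _ _ (Num.max r 0)).
  by rewrite le_max lexx.
by rewrite ltrDl.
Qed.

Lemma closed_ball_rV_compact (r : R) : compact [set x : 'rV[R]_n | `|x| <= r].
Proof.
apply: bounded_closed_compact.
  by exists r; split; rewrite ?num_real// => M rM x /= /le_trans; apply; exact: ltW.
apply: (@closed_comp _ _ (fun x : 'rV[R]_n => `|x|) [set z | z <= r]) => [x _|].
  exact: norm_continuous.
exact: closed_le.
Qed.

Lemma Cc_bounded f : Cc f -> exists2 B : R, 0 < B & forall x, `|f x| <= B.
Proof.
move=> cf; have [r r0 fr] := Cc_radius cf.
have : bounded_set (f @` [set x | `|x| <= r]).
  apply/compact_bounded/continuous_compact; last exact: closed_ball_rV_compact.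
  by apply: continuous_subspaceT; case: cf.
move=> /ex_strict_bound_gt0[B B0 fB]; exists B => // x.
have [xr|rx] := leP `|x| r; first by apply/ltW/fB; exists x.
by rewrite fr ?normr0 ltW.
Qed.

(** Heine-Cantor on the closed ball of radius r + 1, where f vanishes beyond r; if x lies outside
    this ball and y is closer to x than 1, then f vanishes at both. *)
Lemma Cc_unif f (e : R) : Cc f -> 0 < e ->
  exists2 d : R, 0 < d & forall x y, `|x - y| < d -> `|f x - f y| < e.
Proof.
move=> cf e0; have [r r0 fr] := Cc_radius cf.
have P x : [set x | `|x| <= r + 1] x -> \forall x' \near x & d \near 0^'+,
     forall y, `|x' - y| < d -> `|f x' - f y| < e.
  move=> _; case: cf => /(_ x)/cvgrPdist_lt/(_ (e / 2) (divr_gt0 e0 (ltr0Sn _ 1)))/nbhs_ballP[d /= d0 xd] _.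
  near=> x' d' => y x'y.
  have x'x : ball x (d / 2) x' by near: x'; apply: nbhsx_ballx; rewrite divr_gt0.
  have d'd : d' < d / 2 by near: d'; apply: nbhs_right_lt; rewrite divr_gt0.
  have h1 : `|f x - f x'| < e / 2.
    by apply: xd; apply: le_ball x'x; lra.
  have h2 : `|f x - f y| < e / 2.
    apply: xd; rewrite [d]splitr; apply: ball_triangle x'x _.
    by rewrite -ball_normE /=; exact: lt_trans d'd.
  have -> : f x' - f y = (f x - f y) - (f x - f x') by ring.
  by rewrite (le_lt_trans (ler_normB _ _))// [e]splitr ltrD.
have := @closed_ball_rV_compact (r + 1).
move=> /compact_near_coveringP/(_ _ _ (fun (d : R) x =>
  forall y, `|x - y| < d -> `|f x - f y| < e) (at_right_proper_filter 0) P) h.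
have [d [d0 d1 hd]] : exists d : R, [/\ 0 < d, d < 1 &
   forall x, `|x| <= r + 1 -> forall y, `|x - y| < d -> `|f x - f y| < e].
  near (0 : R)^'+ => d; exists d; split.
  - by near: d; exact: nbhs_right_gt.
  - by near: d; exact: nbhs_right_lt.
  - by near: d; exact: h.
exists d => // x y xy; have [xr|rx] := leP `|x| (r + 1); first exact: hd.
rewrite !fr ?subrr ?normr0//; last by rewrite (le_trans _ (ltW rx))// lerDl.
have : `|x| <= `|x - y| + `|y| by rewrite -[in leLHS](subrK y x) ler_normD.
lra.
Unshelve. all: by end_near. Qed.


Lemma CcD f g : Cc f -> Cc g -> Cc (fun x => f x + g x).
Proof.
move=> cf cg; have [r r0 fr] := Cc_radius cf; have [s s0 gs] := Cc_radius cg.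
split=> [x|]; first exact: (cvgD (Cc_continuous cf x) (Cc_continuous cg x)).
exists (Num.max r s) => x; rewrite gt_max => /andP[rx sx].
by rewrite fr ?gs ?addr0 ?ltW.
Qed.

Lemma CcM f g : continuous f -> Cc g -> Cc (fun x => f x * g x).
Proof.
move=> cf cg; have [s s0 gs] := Cc_radius cg.
split=> [x|]; first exact: (cvgM (cf x) (Cc_continuous cg x)).
by exists s => x sx; rewrite gs ?mulr0// ltW.
Qed.

Lemma Cc0 : Cc (fun _ : 'rV[R]_n => 0).
Proof. by split; [exact: cst_continuous|exists 0]. Qed.

Lemma CcZ (k : R) f : Cc f -> Cc (fun x => k * f x).
Proof. by move=> cf; apply: CcM => //; exact: cst_continuous. Qed.

Lemma CcN f : Cc f -> Cc (fun x => - f x).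
Proof.
move=> cf; rewrite (_ : (fun x => _) = (fun x => -1 * f x)); first exact: CcZ.
by apply/funext => x; rewrite mulN1r.
Qed.

Lemma CcB f g : Cc f -> Cc g -> Cc (fun x => f x - g x).
Proof. by move=> cf cg; apply: CcD => //; exact: CcN. Qed.

Lemma Cc_comp_affine f c (s : R) : 0 < s -> Cc f -> Cc (fun x => f (c + s *: x)).
Proof.
move=> s0 cf; have [r r0 fr] := Cc_radius cf.
split=> [x|].
  apply: continuous_comp; last exact: Cc_continuous.
  apply: (@continuousD _ _ _ (fun=> c) (fun z => s *: z) x); first exact: cst_continuous.
  exact: scaler_continuous.
exists ((r + `|c|) / s) => x; rewrite ltr_pdivrMr// => rx; apply: fr.
have : `|s *: x| <= `|c + s *: x| + `|c|.
  by rewrite -[in leLHS](addKr c (s *: x)) addrC; exact: ler_normB.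
rewrite normrZ gtr0_norm//; lra.
Qed.

Definition LI f : R := (\int[lebesgueN R n]_t f (row_of_tuple t))%R.

(** f is bounded and vanishes off the cube [-r, r]^n, whose measure is finite. *)
Lemma Cc_integrable f : Cc f ->
  (lebesgueN R n).-integrable setT (EFin \o (fun t => f (row_of_tuple t))).
Proof.
move=> cf; have [r r0 fr] := Cc_radius cf; have [B B0 fB] := Cc_bounded cf.
pose J : set (measurableTypeR R) := `[- r, r]%classic.
pose A := [set t : n.-tuple (measurableTypeR R) | forall i, J (tnth t i)].
have mA : measurable A by apply: measurable_cube; exact: measurable_itv.
have Ar t : ~ A t -> f (row_of_tuple t) = 0.
  move=> At; apply: fr; rewrite leNgt; apply/negP => tr; apply: At => i.
  rewrite /J /= in_itv /= -ler_norml; apply: le_trans (ltW tr).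
  apply: le_trans (_ : `|row_of_tuple t 0 i| <= _); first by rewrite mxE.
  exact: coord_le_norm.
have : (lebesgueN R n).-integrable A (EFin \o (fun t => f (row_of_tuple t))).
  apply: measurable_bounded_integrable => //.
  - have hA : lebesgueN R n A = ((r - - r) ^+ n)%:E.
      apply: lebesgueN_cube; first exact: measurable_itv.
      by rewrite lebesgue_measure_itv /= lte_fin gtrN.
    by rewrite [X in (X < _)%E]hA ltry.
  - apply: measurable_funTS; apply: continuous_row_measurable.
    by case: cf.
  - by exists B; split; rewrite ?num_real// => M BM t _ /=; rewrite (le_trans (fB _)) ?ltW.
move/(integrable_mkcond _ mA).
apply: eq_integrable => // t _; rewrite /patch; case: ifPn => //= /negP At.
by rewrite Ar// => /mem_set.
Qed.

Lemma LID f g : Cc f -> Cc g -> LI (fun x => f x + g x) = LI f + LI g.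
Proof. by move=> cf cg; rewrite /LI RintegralD//; exact: Cc_integrable. Qed.

Lemma LIB f g : Cc f -> Cc g -> LI (fun x => f x - g x) = LI f - LI g.
Proof. by move=> cf cg; rewrite /LI RintegralB//; exact: Cc_integrable. Qed.

Lemma LIZ (k : R) f : Cc f -> LI (fun x => k * f x) = k * LI f.
Proof. by move=> cf; rewrite /LI RintegralZl//; exact: Cc_integrable. Qed.

Lemma LI_ge0 f : (forall x, 0 <= f x) -> 0 <= LI f.
Proof. by move=> f0; exact: Rintegral_ge0. Qed.

Lemma LI_le f g : Cc f -> Cc g -> (forall x, f x <= g x) -> LI f <= LI g.
Proof.
by move=> cf cg fg; rewrite /LI; apply: le_Rintegral => //; exact: Cc_integrable.
Qed.

Lemma LI0 : LI (fun=> 0) = 0.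
Proof. by rewrite -[RHS](mul0r (LI (fun=> 0))) -LIZ ?mul0r//; exact: Cc0. Qed.

Lemma Cc_LI_sum (I : Type) (r : seq I) (F : I -> 'rV[R]_n -> R) : (forall i, Cc (F i)) ->
  Cc (fun x => \sum_(i <- r) F i x) /\
  LI (fun x => \sum_(i <- r) F i x) = \sum_(i <- r) LI (F i).
Proof.
move=> cF; elim: r => [|i r [IH1 IH2]].
  rewrite (_ : (fun x => _) = (fun=> 0)); last by apply/funext => x; rewrite big_nil.
  by rewrite LI0 big_nil; split => //; exact: Cc0.
rewrite (_ : (fun x => _) = (fun x => F i x + \sum_(i <- r) F i x)); last first.
  by apply/funext => x; rewrite big_cons.
by rewrite LID// big_cons IH2; split => //; exact: CcD.
Qed.

Lemma LI_norm_le f g : Cc f -> Cc g -> (forall x, `|f x| <= g x) -> `|LI f| <= LI g.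
Proof.
move=> cf cg fg; rewrite ler_norml; apply/andP; split.
  rewrite -mulN1r -LIZ//; apply: LI_le => //; first exact: CcZ.
  by move=> x; rewrite mulN1r; have := fg x; rewrite ler_norml => /andP[].
by apply: LI_le => // x; rewrite (le_trans (ler_norm _)).
Qed.

End CompactlySupported.

(** * Affine substitutions and bounds for the integral *)

Section Invariance.
Context {R : realType} {n : nat}.
Implicit Types (f g : 'rV[R]_n -> R) (x y c : 'rV[R]_n).

Lemma row_of_tuple_affine c (s : R) (t : n.-tuple (measurableTypeR R)) :
  row_of_tuple (tuple_affine [tuple (c 0 i : measurableTypeR R) | i < n] s t) =
  c + s *: row_of_tuple t.
Proof. by apply/rowP => i; rewrite !mxE !tnth_mktuple. Qed.

Lemma EFin_LI f : Cc f ->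
  ((LI f)%:E = \int[lebesgueN R n]_t (f (row_of_tuple t))%:E)%E.
Proof. by move=> cf; rewrite /LI /Rintegral fineK// integrable_fin_num// Cc_integrable. Qed.

Let LI_affine_ge0 f c (s : R) : 0 < s -> Cc f -> (forall x, 0 <= f x) ->
  LI (fun y => f (c + s *: y)) = s ^- n * LI f.
Proof.
move=> s0 cf f0; apply/EFin_inj; rewrite EFinM !EFin_LI//; last exact: Cc_comp_affine.
under eq_integral do rewrite -row_of_tuple_affine.
rewrite (@ge0_integral_tuple_affine _ n _ s (fun t => (f (row_of_tuple t))%:E))//.
- by apply/measurable_EFinP; apply: continuous_row_measurable; case: cf.
- by move=> t; rewrite lee_fin.
Qed.

(** The extended integral settles the nonnegative case; in general f is the difference of |f| + f
    and |f|, both nonnegative with compact support. *)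
Lemma LI_affine f c (s : R) : 0 < s -> Cc f ->
  LI (fun y => f (c + s *: y)) = s ^- n * LI f.
Proof.
move=> s0 cf.
have cn : Cc (fun x => `|f x|).
  have [r r0 fr] := Cc_radius cf; split=> [x|].
    by apply: continuous_comp; [exact: Cc_continuous|exact: norm_continuous].
  by exists r => x rx; rewrite fr ?normr0 ?ltW.
have cp : Cc (fun x => `|f x| + f x) by exact: CcD.
have -> : LI f = LI (fun x => `|f x| + f x) - LI (fun x => `|f x|).
  by rewrite -LIB//; congr LI; apply/funext => x; ring.
have -> : LI (fun y => f (c + s *: y)) =
   LI (fun y => `|f (c + s *: y)| + f (c + s *: y)) - LI (fun y => `|f (c + s *: y)|).
  rewrite -LIB; first by congr LI; apply/funext => x; ring.
    exact: (Cc_comp_affine c s0 cp).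
  exact: (Cc_comp_affine c s0 cn).
rewrite mulrBr (@LI_affine_ge0 (fun x => `|f x| + f x))//; last first.
  by move=> x; rewrite -lerBlDr sub0r; have := ler_norm (- f x); rewrite normrN.
by rewrite (@LI_affine_ge0 (fun x => `|f x|)).
Qed.

Lemma LI_translate f c : Cc f -> LI (fun y => f (c + y)) = LI f.
Proof.
move=> cf; rewrite -[RHS]mul1r -[X in X * _](@invr1 R) -(expr1n _ n).
by rewrite -(LI_affine c ltr01 cf); congr LI; apply/funext => y; rewrite scale1r.
Qed.

(** f dominates e times the indicator of the cube [-r, r]^n, which has positive measure. *)
Lemma LI_gt0 f (e r : R) : Cc f -> (forall x, 0 <= f x) -> 0 < e -> 0 < r ->
  (forall x, (forall i, `|x 0 i| <= r) -> e <= f x) -> 0 < LI f.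
Proof.
move=> cf f0 e0 r0 fe.
pose J : set (measurableTypeR R) := `[- r, r]%classic.
pose A := [set t : n.-tuple (measurableTypeR R) | forall i, J (tnth t i)].
have mA : measurable A by apply: measurable_cube; exact: measurable_itv.
have hA : lebesgueN R n A = ((r - - r) ^+ n)%:E.
  apply: lebesgueN_cube; first exact: measurable_itv.
  by rewrite lebesgue_measure_itv /= lte_fin gtrN.
apply: (@lt_le_trans _ _ (e * (r - - r) ^+ n)).
  by rewrite mulr_gt0// exprn_gt0// opprK addr_gt0.
rewrite -lee_fin EFinM -hA EFin_LI// -[leLHS]integral_cst//.
rewrite [leLHS]integral_mkcond; apply: ge0_le_integral => //.
- by move=> t _; rewrite /patch; case: ifPn => // _; rewrite lee_fin ltW.
- by apply/(measurable_restrictT _ _).1 => //; exact: measurable_cst.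
- by apply/measurable_EFinP; apply: continuous_row_measurable; case: cf.
move=> t _; rewrite /patch; case: ifPn => [/[!inE] At|_]; rewrite lee_fin//.
by apply: fe => i; rewrite mxE ler_norml; have := At i; rewrite /J /= in_itv.
Qed.

Lemma Cc_LI_small (r : R) : 0 < r -> exists2 V : R, 0 <= V &
  forall f (e : R), Cc f -> (forall x, r <= `|x| -> f x = 0) ->
    (forall x, `|f x| <= e) -> `|LI f| <= e * V.
Proof.
(* A continuous cutoff that is at least 1 on the ball of radius r, so that e chi dominates |f|; its
   integral serves as V for all f at once. *)
move=> r0; pose chi x : R := Num.max 0 (r + 1 - `|x|).
have cchi : Cc chi.
  split=> [x|].
    apply: (@continuous_comp _ _ _ (fun x => r + 1 - `|x|) (fun z : R => Num.max 0 z)).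
      apply: continuousB; first exact: cst_continuous.
      exact: norm_continuous.
    by apply: continuous_max; [exact: cst_continuous|move=> z; exact: cvg_id].
  exists (r + 1) => x rx; rewrite /chi max_l//; lra.
have chi0 x : 0 <= chi x by rewrite /chi le_max lexx.
exists (LI chi) => [|f e cf fr fe]; first exact: LI_ge0.
rewrite -LIZ//; apply: LI_norm_le => // [|x]; first exact: CcZ.
have e0 : 0 <= e by rewrite (le_trans _ (fe 0)).
have [rx|xr] := leP r `|x|; first by rewrite fr// normr0 mulr_ge0.
rewrite (le_trans (fe x))// ler_peMr// /chi le_max; apply/orP; right; lra.
Qed.

End Invariance.

(** * Directional derivatives *)

Section Directional.
Context {R : realType} {V : normedModType R}.
Implicit Types (f : V -> R) (x v : V).

(** Restriction to a line reduces directional derivatives to one real variable, where the chain rule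
    is at hand. *)
Lemma is_derive_line f x v (t d : R) :
  is_derive (t *: v + x) v f d <-> is_derive t 1 (fun t => f (t *: v + x)) d.
Proof.
have E : (fun h => h^-1 *: ((f \o shift (t *: v + x)) (h *: v) - f (t *: v + x))) =
  (fun h : R => h^-1 *: (((fun t => f (t *: v + x)) \o shift t) (h *: (1 : R)) - f (t *: v + x))).
  by apply/funext => h /=; rewrite addrA -scalerDl [h *: (1 : R)]mulr1.
split=> -[fd <-].
  by split; [rewrite /derivable -E|rewrite /derive E].
by split; [rewrite /derivable E|rewrite /derive E].
Qed.

Lemma is_derive_line0 f x v (d : R) :
  is_derive x v f d <-> is_derive (0 : R) 1 (fun t => f (t *: v + x)) d.
Proof. by rewrite -is_derive_line scale0r add0r. Qed.

Lemma is_derive_comp1 (phi : R -> R) f x v (a d : R) :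
  is_derive (f x) 1 phi a -> is_derive x v f d -> is_derive x v (phi \o f) (a * d).
Proof.
move=> phia /is_derive_line0 fd; apply/is_derive_line0.
rewrite [X in is_derive _ _ X _](_ : _ = phi \o (fun t : R => f (t *: v + x)))//.
by apply: is_derive1_comp; rewrite /= scale0r add0r.
Qed.

Lemma is_derive_affine f x v (s : R) c (d : R) :
  is_derive (c + s *: x) v f d -> is_derive x v (fun y => f (c + s *: y)) (s * d).
Proof.
move=> /is_derive_line0 fd; apply/is_derive_line0.
rewrite (_ : (fun t => _) = (fun t => f (t *: v + (c + s *: x))) \o (fun t : R => t * s)); last first.
  by apply/funext => t /=; rewrite scalerDr scalerA mulrC addrCA.
rewrite mulrC; apply: is_derive1_comp; rewrite ?mul0r//.
by apply: is_derive_eq; rewrite /GRing.scale /= mulr1 mulr0 add0r.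
Qed.

Lemma is_derive_eps (F : R -> R) (s L : R) :
  (forall e : R, 0 < e -> exists2 d : R, 0 < d &
     forall h, `|h| < d -> `|F (s + h) - F s - h * L| <= e * `|h|) ->
  is_derive s 1 F L.
Proof.
move=> H.
have lim : (fun h : R => h^-1 *: ((F \o shift s) (h *: (1 : R)) - F s)) @ 0^' --> L.
  apply/cvgrPdist_le => e e0; have [d d0 Hd] := H e e0.
  near=> h.
  have h0 : h != 0 by near: h; exact: nbhs_dnbhs_neq.
  rewrite /= [h *: (1 : R)]mulr1 distrC [h + s]addrC.
  have -> : h^-1 *: (F (s + h) - F s) - L = h^-1 * (F (s + h) - F s - h * L).
    by rewrite /GRing.scale /=; field.
  rewrite normrM normfV ler_pdivrMl ?normr_gt0// [leRHS]mulrC; apply: Hd.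
  near: h; exact: dnbhs0_lt.
split; first by apply/cvg_ex; exists L.
exact/cvg_lim.
Unshelve. all: by end_near. Qed.
End Directional.

(** * First-order expansions that are uniform in the base point *)

Section UniformDerivatives.
Context {R : realType} {n : nat}.
Implicit Types (f v w : 'rV[R]_n -> R) (x y z : 'rV[R]_n).
Local Notation e_ i := (delta_mx 0 i : 'rV[R]_n).

Lemma norm_delta_le (i : 'I_n) (h : R) : `|h *: e_ i| <= `|h|.
Proof.
rewrite normrZ ler_piMr// [leLHS]/Num.norm /= mx_normrE.
apply/bigmax_leP; split=> // -[j k] _ /=; rewrite mxE.
by case: (_ && _); rewrite ?normr1 ?normr0.
Qed.

Definition C1c v := Cc v /\ forall i, (forall x, derivable v x (e_ i)) /\ Cc (partial i v).

Lemma partial_mvt v (i : 'I_n) x (h : R) :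
  (forall x, derivable v x (e_ i)) ->
  exists2 t : R, `|t| <= `|h| & v (x + h *: e_ i) - v x = h * partial i v (x + t *: e_ i).
Proof.
move=> dv.
have D (t : R) : is_derive t 1 (fun t => v (t *: e_ i + x)) (partial i v (x + t *: e_ i)).
  apply: (is_derive_line v x (e_ i) t _).1.
  by rewrite addrC; exact: derivableP.
have C (a b : R) : {within `[a, b], continuous (fun t => v (t *: e_ i + x))}.
  apply: derivable_within_continuous => t _; have [+ _] := D t; exact.
have [h0|h0] := leP 0 h.
  have [c cin E] := MVT_segment h0 (fun t _ => D t) (C _ _).
  move: cin; rewrite in_itv /= => /andP[c0 ch]; exists c.
    by rewrite !ger0_norm.
  by move: E; rewrite scale0r add0r subr0 [h *: _ + x]addrC => ->; rewrite mulrC.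
have [c cin E] := MVT_segment (ltW h0) (fun t _ => D t) (C _ _).
move: cin; rewrite in_itv /= => /andP[c0 ch]; exists c.
  by rewrite !ler0_norm ?lerN2// ltW.
move: E; rewrite scale0r add0r sub0r [h *: _ + x]addrC => E'.
rewrite -opprB E'; ring.
Qed.

(** The increment is h times the derivative at a point at distance at most |h|, and the derivative
    is uniformly continuous. *)
Lemma partial_unif v (i : 'I_n) (e : R) :
  (forall x, derivable v x (e_ i)) -> Cc (partial i v) -> 0 < e ->
  exists2 d : R, 0 < d & forall x h, `|h| < d ->
    `|v (x + h *: e_ i) - v x - h * partial i v x| <= e * `|h|.
Proof.
move=> dv cv e0; have [d d0 Hd] := Cc_unif cv e0; exists d => // x h hd.
have [t th ->] := partial_mvt x h dv.
rewrite -mulrBr normrM mulrC ler_wpM2r//; apply/ltW/Hd.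
by rewrite addrC addKr (le_lt_trans (norm_delta_le _ _))// (le_lt_trans th).
Qed.

(* Translation invariance kills the integral of every difference quotient. *)
Lemma LI_partial v (i : 'I_n) :
  Cc v -> (forall x, derivable v x (e_ i)) -> Cc (partial i v) ->
  LI (partial i v) = 0.
Proof.
move=> cv dv cdv; have [r r0 vr] := Cc_radius cv; have [s s0 dvs] := Cc_radius cdv.
have t0 : 0 < r + s + 1 by rewrite !addr_gt0.
have [V V0 HV] := @Cc_LI_small R n _ t0.
apply/eqP; rewrite -normr_le0; apply/ler_addgt0Pr => e e0; rewrite add0r.
have e'0 : 0 < e / (V + 1) by rewrite divr_gt0// ltr_wpDl.
have [d d0 Hd] := partial_unif dv cdv e'0.
(* A step of size at most 1 keeps the support of the remainder within radius r + s + 1, so that one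
   V serves for every e. *)
pose h := Num.min (d / 2) 1.
have h0 : 0 < h by rewrite lt_min ltr01 divr_gt0.
have h1 : h <= 1 by rewrite ge_min lexx orbT.
have hd : h < d by rewrite gt_min; apply/orP; left; lra.
have ct : Cc (fun x => v (h *: e_ i + x)).
  rewrite (_ : (fun x => _) = (fun x => v (h *: e_ i + 1 *: x))); first exact: Cc_comp_affine.
  by apply/funext => x; rewrite scale1r.
have := HV (fun x => v (h *: e_ i + x) - v x - h * partial i v x) (e / (V + 1) * h).
rewrite LIB ?LIB ?LIZ//; last 2 first.
- exact: CcB.
- exact: CcZ.
rewrite LI_translate// subrr sub0r normrN normrM (gtr0_norm h0) => H.
have : h * `|LI (partial i v)| <= e / (V + 1) * h * V.
  apply: H => [|x rx|x]; first by apply: CcB; [exact: CcB|exact: CcZ].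
    rewrite !vr ?dvs ?mulr0 ?subr0//; [lra|lra|].
    have := @ler_normB _ _ (h *: e_ i + x) (h *: e_ i); rewrite addrC addKr.
    have := @norm_delta_le i h; rewrite (gtr0_norm h0); lra.
  by rewrite [h *: _ + x]addrC -[X in _ <= _ * X](gtr0_norm h0); apply: Hd; rewrite gtr0_norm.
rewrite mulrAC [leRHS]mulrC ler_pM2l// => /le_trans; apply.
by rewrite -mulrA ler_piMr ?(ltW e0)// ler_pdivrMl ?mulr1 ?lerDl// ltr_wpDl.
Qed.

(** The point x + z is reached by one coordinate step at a time. A step costs e' |z| for the
    expansion at its starting point and e' |z| for moving the partial derivative back to x, in all 2
    n e' |z| <= e |z|. *)
Lemma gradient_unif v (e : R) : C1c v -> 0 < e ->
  exists2 d : R, 0 < d & forall x z, `|z| < d ->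
    `|v (x + z) - v x - \sum_i z 0 i * partial i v x| <= e * `|z|.
Proof.
move=> [cv cdv] e0.
pose e' := e / (2 * n%:R + 1).
have e'0 : 0 < e' by rewrite divr_gt0// ltr_wpDl// mulr_ge0.
have /choice[d1 Hd1] : forall i, exists d : R, 0 < d /\ forall x h, `|h| < d ->
    `|v (x + h *: e_ i) - v x - h * partial i v x| <= e' * `|h|.
  by move=> i; have [d d0 Hd] := partial_unif (cdv i).1 (cdv i).2 e'0; exists d.
have /choice[d2 Hd2] : forall i, exists d : R, 0 < d /\ forall x y, `|x - y| < d ->
    `|partial i v x - partial i v y| < e'.
  by move=> i; have [d d0 Hd] := Cc_unif (cdv i).2 e'0; exists d.
pose d := \big[Num.min/1]_i (Num.min (d1 i) (d2 i)).
have d0 : 0 < d.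
  by apply/bigmin_gtP; split=> // i _; rewrite lt_min (Hd1 i).1 (Hd2 i).1.
exists (d / (n%:R + 1)) => [|x z zd]; first by rewrite divr_gt0// ltr_wpDl.
have n10 : 0 < n%:R + 1 :> R by rewrite ltr_wpDl.
have zd' : (n%:R + 1) * `|z| < d by rewrite mulrC -ltr_pdivlMr.
(* The list holds the coordinates already moved; the second bound keeps the intermediate point close
   enough to x for uniform continuity. *)
have key (s : seq 'I_n) : (size s <= n)%N ->
    `|v (x + \sum_(i <- s) z 0 i *: e_ i) - v x - \sum_(i <- s) z 0 i * partial i v x|
      <= (2 * (size s)%:R) * e' * `|z| /\
    `|\sum_(i <- s) z 0 i *: e_ i| <= (size s)%:R * `|z|.
  elim: s => [_|i s IH sn].
    by rewrite !big_nil addr0 !subrr !normr0 mulr0 !mul0r.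
  have [IH1 IH2] := IH (ltnW sn).
  rewrite !big_cons /=; set S := \sum_(i <- s) _; set T := \sum_(i <- s) _ .
  have zi : `|z 0 i| <= `|z| by exact: coord_le_norm.
  have S1 : (size s).+1%:R = (size s)%:R + 1 :> R by rewrite -natr1.
  split; last first.
    rewrite S1 mulrDl mul1r addrC (le_trans (ler_normD _ _))// lerD//.
    by rewrite (le_trans (norm_delta_le _ _)).
  have a1 := (Hd1 i).2 (x + S) (z 0 i).
  have a2 := (Hd2 i).2 (x + S) x.
  have di1 : d <= d1 i by apply: le_trans (bigmin_le _ i _) _; rewrite ge_min lexx.
  have di2 : d <= d2 i by apply: le_trans (bigmin_le _ i _) _; rewrite ge_min lexx orbT.
  have sz : (size s)%:R * `|z| <= n%:R * `|z| by rewrite ler_wpM2r// ler_nat ltnW.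
  have z0 : 0 <= `|z| by [].
  have nz : 0 <= n%:R * `|z| by rewrite mulr_ge0.
  have {}a1 := a1 (lt_le_trans (le_lt_trans zi (le_lt_trans _ zd')) di1).
  have {}a1 : `|v (x + S + z 0 i *: e_ i) - v (x + S) - z 0 i * partial i v (x + S)| <= e' * `|z 0 i|.
    apply: a1; rewrite mulrDl mul1r lerDr//.
  have {}a2 : `|partial i v (x + S) - partial i v x| < e'.
    apply: a2; rewrite addrC addKr (le_lt_trans IH2)// (le_lt_trans sz)//.
    by rewrite (lt_le_trans _ di2)// (le_lt_trans _ zd')// mulrDl mul1r lerDl.
  have -> : v (x + (z 0 i *: e_ i + S)) - v x - (z 0 i * partial i v x + T) =
    (v (x + S + z 0 i *: e_ i) - v (x + S) - z 0 i * partial i v (x + S)) +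
    (z 0 i * (partial i v (x + S) - partial i v x) + (v (x + S) - v x - T)).
    by rewrite [z 0 i *: _ + S]addrC addrA; ring.
  apply: le_trans (ler_normD _ _) _.
  have b1 := ler_normD (z 0 i * (partial i v (x + S) - partial i v x)) (v (x + S) - v x - T).
  have b2 : `|z 0 i * (partial i v (x + S) - partial i v x)| <= e' * `|z|.
    by rewrite normrM mulrC ler_pM// ltW.
  have b3 : e' * `|z 0 i| <= e' * `|z| by rewrite ler_pM2l.
  have -> : 2 * (size s).+1%:R * e' * `|z| = 2 * (size s)%:R * e' * `|z| + (e' * `|z| + e' * `|z|).
    by rewrite S1; ring.
  lra.
have [+ _] := key (enum 'I_n) (eq_leq (size_enum_ord n)); rewrite size_enum_ord.
rewrite !big_enum /=.
have -> : \sum_i z 0 i *: e_ i = z by rewrite -row_sum_delta.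
move=> /le_trans; apply; rewrite ler_wpM2r// /e'.
rewrite mulrA ler_pdivrMr ?ltr_wpDl ?mulr_ge0// mulrC ler_pM2l//.
by rewrite lerDl.
Qed.

End UniformDerivatives.

(** * A radial kernel *)

Lemma nondecreasing_is_derive (R : realType) (f df : R -> R) (a b : R) :
  a <= b -> (forall x, a <= x <= b -> is_derive x 1 f (df x)) ->
  (forall x, a <= x <= b -> 0 <= df x) -> f a <= f b.
Proof.
move=> ab fd df0.
have [x||c] := @MVT_segment R f df a b ab.
- by rewrite in_itv /= => /andP[ax xb]; apply: fd; rewrite !ltW.
- apply: derivable_within_continuous => x; rewrite in_itv /= => xab.
  by have [+ _] := fd x xab; exact.
rewrite in_itv /= => cab fE; rewrite -subr_ge0 fE mulr_ge0 ?subr_ge0//.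
exact: df0.
Qed.

Section Kernel.
Context {R : realType}.

Definition pospart (z : R) : R := Num.max 0 z.

Lemma pospart_ge0 z : 0 <= pospart z.
Proof. by rewrite /pospart le_max lexx. Qed.

Lemma ge0_pospart z : 0 <= z -> pospart z = z.
Proof. by move=> z0; rewrite /pospart max_r. Qed.

Lemma le0_pospart z : z <= 0 -> pospart z = 0.
Proof. by move=> z0; rewrite /pospart max_l. Qed.

Lemma continuous_pospart : continuous pospart.
Proof. by move=> z; apply: continuous_max; [exact: cst_continuous|exact: cvg_id]. Qed.

(** For all four sign patterns of z and z + h the remainder is at most h^2. *)
Lemma is_derive_pospart_sqr (z : R) :
  is_derive z 1 (fun z => pospart z ^+ 2) (2 * pospart z).
Proof.
apply: is_derive_eps => e e0; exists e => // h he.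
apply: (@le_trans _ _ (h ^+ 2)); last first.
  by rewrite -real_normK ?num_real// expr2 ler_wpM2r// ltW.
have [z0|z0] := leP 0 z; have [zh|zh] := leP 0 (z + h);
  rewrite ?(ge0_pospart z0) ?(ge0_pospart zh) ?(le0_pospart (ltW z0)) ?(le0_pospart (ltW zh));
  by rewrite ler_norml; apply/andP; split; nra.
Qed.

(** Product rule for z_+^3 = z z_+^2. The cube is the lowest integer power of z_+ that is of class
    C^2. *)
Lemma is_derive_pospart_cube (z : R) :
  is_derive z 1 (fun z => pospart z ^+ 3) (3 * pospart z ^+ 2).
Proof.
have -> : (fun z => pospart z ^+ 3) = id * (fun z => pospart z ^+ 2).
  apply/funext => y; rewrite /GRing.mul /=.
  have [y0|y0] := leP 0 y; first by rewrite ge0_pospart// exprS.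
  by rewrite le0_pospart ?(ltW y0)// !expr0n/= mulr0.
have D := is_derive_pospart_sqr z.
apply: is_derive_eq; rewrite /GRing.scale /=.
have [z0|z0] := leP 0 z; first by rewrite ge0_pospart//; ring.
by rewrite le0_pospart ?(ltW z0)//; ring.
Qed.

Context {n : nat}.
Implicit Types (x y : 'rV[R]_n).
Local Notation e_ i := (delta_mx 0 i : 'rV[R]_n).

Definition sqn y : R := \sum_i y 0 i ^+ 2.

Lemma continuous_sqn : continuous sqn.
Proof.
apply: (@continuous_big R 'I_n _ 0 xpredT _ 'rV[R]_n _
  (fun (i : 'I_n) (z : 'rV[R]_n) => z 0 i ^+ 2)) => [|i _ y].
  exact: add_continuous.
apply: (@continuous_comp _ _ _ (fun z : 'rV[R]_n => z 0 i) (fun t : R => t ^+ 2)).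
  exact: coord_continuous.
exact: exprn_continuous.
Qed.

Lemma is_derive_sqn (i : 'I_n) y : is_derive y (e_ i) sqn (2 * y 0 i).
Proof.
apply/is_derive_line0.
have -> : (fun t : R => sqn (t *: e_ i + y)) =
   (fun t : R => sqn y + (t ^+ 2 + t * (2 * y 0 i))).
  apply/funext => t; rewrite /sqn (bigD1 i)//= [in RHS](bigD1 i)//= !mxE !eqxx /=.
  have -> : \sum_(j < n | j != i) (t *: e_ i + y) 0 j ^+ 2 = \sum_(j < n | j != i) y 0 j ^+ 2.
    by apply: eq_bigr => j ji; rewrite !mxE eqxx /= (negbTE ji) mulr0 add0r.
  ring.
apply: is_derive_eq; rewrite /GRing.scale /=; ring.
Qed.

Lemma sqr_coord_le_sqn y i : y 0 i ^+ 2 <= sqn y.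
Proof.
by rewrite /sqn (bigD1 i)//= lerDl sumr_ge0// => j _; exact: sqr_ge0.
Qed.

Lemma norm_ge1_sqn y : 1 <= `|y| -> 1 <= sqn y.
Proof.
rewrite [X in _ <= X]/Num.norm /= mx_normrE => /bigmax_geP[|[[j i] _ /=]].
  by rewrite ler10.
rewrite ord1 => y1; apply: le_trans (sqr_coord_le_sqn y i).
by rewrite -real_normK ?num_real// expr_ge1.
Qed.

(* Chosen so that the gradient of [qbump] at y is [- dbump y *: y], see
   [is_derive_qbump]. *)
Definition qbump y : R := pospart (1 - sqn y) ^+ 2.
Definition dbump y : R := 4 * pospart (1 - sqn y).

Lemma continuous_pospart_sqn : continuous (fun y => pospart (1 - sqn y)).
Proof.
move=> y; apply: (@continuous_comp _ _ _ (fun y => 1 - sqn y)); last exact: continuous_pospart.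
by apply: continuousB; [exact: cst_continuous|exact: continuous_sqn].
Qed.

Lemma dbump_eq0 y : 1 <= `|y| -> dbump y = 0.
Proof. by move=> /norm_ge1_sqn y1; rewrite /dbump le0_pospart ?mulr0// subr_le0. Qed.

Lemma Cc_dbump : Cc dbump.
Proof.
apply: CcZ; split; first exact: continuous_pospart_sqn.
by exists 1 => y /ltW/norm_ge1_sqn y1; rewrite le0_pospart// subr_le0.
Qed.

Lemma Cc_qbump : Cc qbump.
Proof.
split=> [y|].
  apply: (@continuous_comp _ _ _ (fun y => pospart (1 - sqn y)) (fun t : R => t ^+ 2)).
    exact: continuous_pospart_sqn.
  exact: exprn_continuous.
exists 1 => y /ltW/norm_ge1_sqn y1.
by rewrite /qbump le0_pospart ?expr0n// subr_le0.
Qed.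

Lemma qbump_ge0 y : 0 <= qbump y.
Proof. exact: sqr_ge0. Qed.

Lemma dbump_ge0 y : 0 <= dbump y.
Proof. by rewrite mulr_ge0// pospart_ge0. Qed.

Lemma dbump_le4 y : dbump y <= 4.
Proof.
rewrite /dbump ler_piMr// /pospart ge_max ler01 /= lerBlDr lerDl.
by apply: sumr_ge0 => i _; exact: sqr_ge0.
Qed.

Lemma is_derive_qbump (i : 'I_n) y : is_derive y (e_ i) qbump (- (y 0 i * dbump y)).
Proof.
have D1 := is_derive_pospart_sqr (1 - sqn y).
have D2 : is_derive y (e_ i) (cst 1 - sqn) (0 - 2 * y 0 i).
  by have D := is_derive_sqn i y; apply: is_deriveB.
have := is_derive_comp1 (f := cst 1 - sqn) D1 D2.
by move=> D; apply: is_derive_eq; rewrite /dbump; ring.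
Qed.

(** The coordinates are at most 1 in modulus, so the squares are at most the moduli, and n of these
    sum to at most n / (2 (n + 1)). *)
Let sqn_small y : (forall i, `|y 0 i| <= (2 * (n%:R + 1))^-1) -> sqn y <= 2^-1.
Proof.
move=> h; have n1 : 0 < n%:R + 1 :> R by rewrite ltr_wpDl.
have c0 : 0 < (2 * (n%:R + 1))^-1 :> R by rewrite invr_gt0 mulr_gt0.
apply: (@le_trans _ _ (\sum_(i < n) (2 * (n%:R + 1))^-1)).
  apply: ler_sum => i _; rewrite -real_normK ?num_real// expr2.
  apply: le_trans (h i); rewrite ler_piMr// (le_trans (h i))// invf_le1 ?mulr_gt0//.
  have : 0 <= n%:R :> R by []. lra.
rewrite sumr_const card_ord -[leLHS]mulr_natr mulrC ler_pdivrMr ?mulr_gt0//.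
rewrite mulrA mulVf// mul1r lerDl//.
Qed.

Lemma LI_dbump_gt0 : 0 < LI dbump.
Proof.
have n1 : 0 < n%:R + 1 :> R by rewrite ltr_wpDl.
apply: (LI_gt0 Cc_dbump dbump_ge0 (e := 2) (r := (2 * (n%:R + 1))^-1)) => //.
move=> y /sqn_small y2; rewrite /dbump ge0_pospart; lra.
Qed.

Lemma LI_qbump_gt0 : 0 < LI qbump.
Proof.
have n1 : 0 < n%:R + 1 :> R by rewrite ltr_wpDl.
apply: (LI_gt0 Cc_qbump qbump_ge0 (e := 4^-1) (r := (2 * (n%:R + 1))^-1)) => //.
move=> y /sqn_small y2; rewrite /qbump ge0_pospart; first nra.
lra.
Qed.

End Kernel.

(** * Averages of a function at scale s *)

Section Smearing.
Context {R : realType} {n : nat}.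
Implicit Types (f v w : 'rV[R]_n -> R) (x y z : 'rV[R]_n) (s : R).
Local Notation e_ i := (delta_mx 0 i : 'rV[R]_n).

Definition C2c v := C1c v /\ forall i,
  (forall x, derivable (partial i v) x (e_ i)) /\ Cc (partial i (partial i v)).

Lemma continuous_affine (x : 'rV[R]_n) s f : continuous f ->
  continuous (fun y => f (x + s *: y)).
Proof.
move=> cf y; apply: (@continuous_comp _ _ _ (fun y => x + s *: y) f); last exact: cf.
apply: (@continuousD _ _ _ (fun=> x) (fun z => s *: z) y); first exact: cst_continuous.
exact: scaler_continuous.
Qed.

(** The average is not normalised: the mass of the kernel remains as a factor, see [smear0]. *)
Definition smear v x s : R := LI (fun y => v (x + s *: y) * dbump y).

Definition dsmear v x s : R :=
  LI (fun y => \sum_i partial i v (x + s *: y) * (y 0 i * dbump y)).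

Lemma Cc_coord_dbump (i : 'I_n) : Cc (fun y : 'rV[R]_n => y 0 i * dbump y).
Proof. by apply: CcM Cc_dbump; exact: coord_continuous. Qed.

Lemma Cc_smear v x s : Cc v -> Cc (fun y => v (x + s *: y) * dbump y).
Proof. by move=> cv; apply: CcM Cc_dbump; apply/continuous_affine/Cc_continuous. Qed.

Lemma Cc_dsmear v x s (i : 'I_n) : Cc (partial i v) ->
  Cc (fun y => partial i v (x + s *: y) * (y 0 i * dbump y)).
Proof.
by move=> cv; apply: CcM (Cc_coord_dbump i); apply/continuous_affine/Cc_continuous.
Qed.

(** Differentiation under the integral sign: the expansion of v is uniform in the base point and the
    kernel vanishes off the unit ball. *)
Lemma is_derive_smear v x s : C1c v -> is_derive s 1 (smear v x) (dsmear v x s).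
Proof.
move=> C1; have [cv cdv] := C1.
have [V V0 HV] := @Cc_LI_small R n 1 ltr01.
apply: is_derive_eps => e e0.
(* The 4 bounds the kernel and V accounts for integration over the unit ball; V itself could be
   0. *)
have e'0 : 0 < e / (4 * (V + 1)) by rewrite divr_gt0// mulr_gt0// ltr_wpDl.
have [d d0 Hd] := gradient_unif C1 e'0.
exists d => // h hd.
have cs := fun s => Cc_smear x s cv.
have [cd _] := Cc_LI_sum (index_enum 'I_n) (fun i => Cc_dsmear x s (cdv i).2).
rewrite /smear /dsmear -LIB// -LIZ// -LIB//; [|exact: CcB|exact: CcZ].
have key : e / (4 * (V + 1)) * `|h| * 4 * V <= e * `|h|.
  rewrite (_ : _ * V = e * (V / (V + 1)) * `|h|); last first.
    by field; rewrite gt_eqF// ltr_wpDl.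
  rewrite ler_wpM2r//.
  by rewrite ler_piMr ?ltW// ?ltr_pdivrMr ?mul1r ?ltrDl// ltr_wpDl.
apply: le_trans key; apply: HV => [|y y1|y].
- by apply: CcB; [exact: CcB|exact: CcZ].
- rewrite (dbump_eq0 y1) !mulr0 subrr sub0r big1 ?mulr0 ?oppr0// => i _.
  by rewrite !mulr0.
have -> : v (x + (s + h) *: y) * dbump y - v (x + s *: y) * dbump y -
   h * (\sum_i partial i v (x + s *: y) * (y 0 i * dbump y)) =
   (v ((x + s *: y) + h *: y) - v (x + s *: y)
     - \sum_i (h *: y) 0 i * partial i v (x + s *: y)) * dbump y.
  rewrite scalerDl addrA !mulrBl; congr (_ - _).
  rewrite big_distrl big_distrr /=; apply: eq_bigr => i _; rewrite mxE; ring.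
have [y1|y1] := leP 1 `|y|.
  by rewrite dbump_eq0// mulr0 normr0 mulr_ge0// mulr_ge0// ltW.
have hy : `|h *: y| <= `|h| by rewrite normrZ ler_piMr// ltW.
rewrite normrM (ger0_norm (dbump_ge0 y)) ler_pM ?dbump_ge0 ?dbump_le4//.
apply: le_trans (Hd _ _ (le_lt_trans hy hd)) _.
by rewrite ler_wpM2l// ltW.
Qed.

Lemma smear0 v x : smear v x 0 = v x * LI (@dbump R n).
Proof.
rewrite /smear -LIZ; last exact: Cc_dbump.
by congr LI; apply/funext => y; rewrite scale0r addr0.
Qed.

(* Integration by parts, moving the factor [y *: dbump y] to [- grad qbump]. *)
Lemma dsmear_laplacian v x s : C2c v ->
  dsmear v x s = s * LI (fun y => laplacian v (x + s *: y) * qbump y).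
Proof.
move=> [[cv cdv] cddv].
have c1 i : Cc (fun y => partial i (partial i v) (x + s *: y) * qbump y).
  apply: CcM Cc_qbump; apply/continuous_affine/Cc_continuous; exact: (cddv i).2.
have c2 i := Cc_dsmear x s (cdv i).2.
have -> : (fun y => laplacian v (x + s *: y) * qbump y) =
   (fun y => \sum_i partial i (partial i v) (x + s *: y) * qbump y).
  by apply/funext => y; rewrite /laplacian big_distrl.
rewrite /dsmear (Cc_LI_sum _ c1).2 (Cc_LI_sum _ c2).2 big_distrr /=.
apply: eq_bigr => i _; apply/eqP; rewrite eq_sym -subr_eq0 -LIZ// -LIB//; last exact: CcZ.
(* The i-th derivative of w is the difference of the two integrands, so [LI_partial] gives their
   equality after integration. *)
pose w y := partial i v (x + s *: y) * qbump y.
have D y : is_derive y (e_ i) w (s * (partial i (partial i v) (x + s *: y) * qbump y)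
   - partial i v (x + s *: y) * (y 0 i * dbump y)).
  have D1 := is_derive_qbump i y.
  have D2 : is_derive y (e_ i) (fun y => partial i v (x + s *: y))
     (s * partial i (partial i v) (x + s *: y)).
    by apply: is_derive_affine; apply: derivableP; exact: (cddv i).1.
  have D3 := is_deriveM D2 D1.
  by apply: is_derive_eq D3 _; rewrite /GRing.scale /=; ring.
have pw : partial i w = (fun y => s * (partial i (partial i v) (x + s *: y) * qbump y)
   - partial i v (x + s *: y) * (y 0 i * dbump y)).
  by apply/funext => y; have [_ +] := D y; exact.
have cw : Cc w.
  by apply: CcM Cc_qbump; apply/continuous_affine/Cc_continuous; exact: (cdv i).2.
have cpw : Cc (partial i w) by rewrite pw; apply: CcB => //; exact: CcZ.
by rewrite -pw LI_partial// => y; have [+ _] := D y; exact.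
Qed.

Lemma dsmear_ge v x s (L : R) : C2c v -> 0 <= s ->
  (forall x, - L <= laplacian v x) -> - (L * s * LI (@qbump R n)) <= dsmear v x s.
Proof.
move=> C2 s0 vL; rewrite dsmear_laplacian// -mulrA mulrCA -mulrN ler_wpM2l//.
rewrite -mulNr -LIZ; last exact: Cc_qbump.
have cl : Cc (fun y => laplacian v (x + s *: y) * qbump y).
  have c1 i : Cc (fun y => partial i (partial i v) (x + s *: y) * qbump y).
    apply: CcM Cc_qbump; apply/continuous_affine/Cc_continuous; exact: (C2.2 i).2.
  have [c _] := Cc_LI_sum (index_enum 'I_n) c1.
  rewrite (_ : (fun y => _) =
   (fun y => \sum_i partial i (partial i v) (x + s *: y) * qbump y))//.
  by apply/funext => y; rewrite /laplacian big_distrl.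
apply: LI_le => //; first by apply: CcZ; exact: Cc_qbump.
by move=> y; rewrite ler_wpM2r// qbump_ge0.
Qed.

(** The squared L^2 norm of the vector kernel against which [dsmear] integrates the gradient. *)
Definition C_energy : R := LI (fun y : 'rV[R]_n => \sum_i (y 0 i * dbump y) ^+ 2).

Lemma Cc_sqr f : Cc f -> Cc (fun x => f x ^+ 2).
Proof. by move=> cf; apply: (CcM (Cc_continuous cf) cf). Qed.

(* Young's inequality with weight [th], and dilation. *)
Lemma dsmear_abs v x s (G th : R) : C1c v -> 0 < s -> 0 < th ->
  LI (fun y => \sum_i partial i v y ^+ 2) <= G ->
  - dsmear v x s <= th / 2 * (s ^- n * G) + (2 * th)^-1 * C_energy.
Proof.
move=> [cv cdv] s0 th0 vG.
have c2 i := Cc_sqr (Cc_coord_dbump i).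
have [c3 _] := Cc_LI_sum (index_enum 'I_n) c2.
have [c4 _] := Cc_LI_sum (index_enum 'I_n) (fun i => Cc_sqr (cdv i).2).
have [c5 _] := Cc_LI_sum (index_enum 'I_n) (fun i => Cc_dsmear x s (cdv i).2).
have c6 : Cc (fun y => \sum_i partial i v (x + s *: y) ^+ 2).
  exact: (Cc_comp_affine x s0 c4).
apply: (@le_trans _ _ (th / 2 * LI (fun y => \sum_i partial i v (x + s *: y) ^+ 2)
   + (2 * th)^-1 * C_energy)).
  rewrite /C_energy /dsmear -mulN1r -!LIZ// -LID//; [|exact: CcZ|exact: CcZ].
  apply: LI_le => [||y]; [exact: CcZ|by apply: CcD; exact: CcZ|].
  rewrite mulN1r -sumrN !big_distrr -big_split /=; apply: ler_sum => i _.
  set a := partial _ _ _; set b := y 0 i * _.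
  (* Completing the square: the surplus over - a b is (th a + b)^2 / (2 th). *)
  have -> : th / 2 * a ^+ 2 + (2 * th)^-1 * b ^+ 2 = (th * a + b) ^+ 2 / (2 * th) - a * b.
    by field; rewrite gt_eqF.
  by rewrite lerDr divr_ge0 ?sqr_ge0// mulr_ge0// ltW.
rewrite lerD2r ler_wpM2l ?divr_ge0 ?(ltW th0)//.
rewrite (LI_affine x s0 c4) ler_pM2l// invr_gt0 exprn_gt0//.
Qed.

End Smearing.

(** * Lower bound of the Dirichlet energy from averages at two scales *)

Section EnergyBound.
Context {R : realType} {n : nat}.
Implicit Types (v : 'rV[R]_n -> R) (x y : 'rV[R]_n) (s : R).

Let I1 : R := LI (@dbump R n).
Let I2 : R := LI (@qbump R n).

(** By [dsmear_ge] the function t |-> smear v x t + L I2 t^2 / 2 is nondecreasing on [0, s], and its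
    value at 0 is v(x) I1. *)
Lemma smear_ge v x s (L : R) : C2c v -> 0 <= s -> (forall x, - L <= laplacian v x) ->
  v x * I1 - L * I2 * s ^+ 2 / 2 <= smear v x s.
Proof.
move=> C2 s0 vL.
have := @nondecreasing_is_derive R (fun t => smear v x t + L * I2 / 2 * t ^+ 2)
  (fun t => dsmear v x t + L * I2 * t) 0 s s0.
rewrite smear0 expr0n /= mulr0 addr0 => H.
suff : v x * I1 <= smear v x s + L * I2 / 2 * s ^+ 2 by rewrite /I1; lra.
apply: H => t /andP[t0 _].
  have D := is_derive_smear x t C2.1.
  by apply: is_derive_eq; rewrite /GRing.scale /=; field.
have := dsmear_ge x C2 t0 vL; rewrite -/I2; lra.
Qed.

(** Once the kernel is bounded by 4, dilation leaves s^-n times the integral of v, whose support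
    lies in a fixed ball. *)
Lemma smear_le v x s (mu r V : R) : 0 < s -> Cc v ->
  (forall f (e : R), Cc f -> (forall x, r <= `|x| -> f x = 0) ->
    (forall x, `|f x| <= e) -> `|LI f| <= e * V) ->
  (forall x, r <= `|x| -> v x = 0) -> (forall x, 0 <= v x <= mu) ->
  smear v x s <= 4 * (s ^- n * (mu * V)).
Proof.
move=> s0 cv HV vr vmu.
apply: (@le_trans _ _ (LI (fun y => 4 * v (x + s *: y)))).
  apply: LI_le; [exact: Cc_smear|by apply: CcZ; exact: Cc_comp_affine|move=> y].
  by rewrite mulrC ler_wpM2r ?dbump_le4//; case/andP: (vmu (x + s *: y)).
rewrite LIZ; last exact: Cc_comp_affine.
rewrite (LI_affine x s0 cv) !ler_pM2l ?invr_gt0 ?exprn_gt0//.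
apply: le_trans (ler_norm _) _; apply: HV => // y.
by case/andP: (vmu y) => v0 vm; rewrite ger0_norm.
Qed.

(* The primitive of [s `^ (- k - 1)] is compared with the average; taking
   [n <= 2 + 2 k] with [k > 0] rather than [k = (n - 2) / 2] avoids the logarithm
   of dimension two. *)
Lemma smear_decay v x (G s1 s2 k : R) : C1c v -> 0 < G -> 0 < k -> n%:R <= 2 + 2 * k ->
  LI (fun y => \sum_i partial i v y ^+ 2) <= G -> 0 < s1 -> s1 <= s2 ->
  smear v x s1 - smear v x s2 <=
  Num.sqrt G * ((1 + @C_energy R n * s2 `^ (2 + 2 * k - n%:R)) / 2) / k * s1 `^ (- k).
Proof.
move=> C1 G0 k0 nk vG s10 s12.
set A := (1 + _) / 2; set g := Num.sqrt G.
have g0 : 0 < g by rewrite sqrtr_gt0.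
have gG : G = g ^+ 2 by rewrite sqr_sqrtr// ltW.
have CE0 : 0 <= @C_energy R n.
  by apply: LI_ge0 => y; apply: sumr_ge0 => i _; exact: sqr_ge0.
have := @nondecreasing_is_derive R (fun t => smear v x t - g * A / k * t `^ (- k))
  (fun t => dsmear v x t + g * A * t `^ (- k - 1)) s1 s2 s12.
move=> H.
have : smear v x s1 - g * A / k * s1 `^ (- k) <= smear v x s2 - g * A / k * s2 `^ (- k).
  apply: H => t /andP[t1 t2]; have t0 : 0 < t by exact: lt_le_trans t1.
    have D := is_derive_smear x t C1.
    have D2 := @is_derive1_powR R (- k) t t0.
    by apply: is_derive_eq; rewrite /GRing.scale /=; field; rewrite gt_eqF.
  (* With this weight the two Young terms are g t^(-k-1) / 2 and the same multiplied by c
     t^(2+2k-n), where c is [C_energy]. *)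
  have th0 : 0 < t `^ (n%:R - 1 - k) / g by rewrite divr_gt0// powR_gt0.
  have := dsmear_abs x C1 t0 th0 vG.
  set c := @C_energy R n.
  suff : t `^ (n%:R - 1 - k) / g / 2 * (t ^- n * G) + (2 * (t `^ (n%:R - 1 - k) / g))^-1 * c
    <= g * A * t `^ (- k - 1) by lra.
  have tn0 : t != 0 by rewrite gt_eqF.
  have E1 : t `^ (n%:R - 1 - k) = t `^ (- k - 1) * t ^+ n.
    rewrite -powR_mulrn ?ltW// -powRD ?tn0 ?implybT//; congr (_ `^ _); ring.
  have E2 : t `^ (2 + 2 * k - n%:R) = (t `^ (- k - 1) * t `^ (- k - 1) * t ^+ n)^-1.
    rewrite -powR_mulrn ?ltW// -!powRD ?tn0 ?implybT// -powRN; congr (_ `^ _); ring.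
  (* The exponent is nonnegative, so t may be replaced by the larger s2. *)
  have E3 : t `^ (2 + 2 * k - n%:R) <= s2 `^ (2 + 2 * k - n%:R).
    apply: ge0_ler_powR => //; rewrite ?nnegrE ?subr_ge0//; first exact: ltW.
    by rewrite ltW// (lt_le_trans s10).
  have p0 : 0 < t `^ (- k - 1) by rewrite powR_gt0.
  have q0 : 0 < t ^+ n by rewrite exprn_gt0.
  rewrite E1; move: E3; rewrite E2 /A -/c; set P := t `^ _ in p0 *; set Q := t ^+ n in q0 *.
  set W := s2 `^ _ => E3.
  have -> : P * Q / g / 2 * (Q^-1 * G) + (2 * (P * Q / g))^-1 * c
    = g * P / 2 * (1 + c * (P * P * Q)^-1).
    by rewrite gG; field; rewrite !gt_eqF.
  have -> : g * ((1 + c * W) / 2) * P = g * P / 2 * (1 + c * W) by ring.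
  by rewrite ler_pM2l ?divr_gt0 ?mulr_gt0// lerD2l ler_wpM2l.
have : 0 <= g * A / k * s2 `^ (- k).
  rewrite mulr_ge0 ?powR_ge0// divr_ge0 ?(ltW k0)// mulr_ge0 ?(ltW g0)//.
  by rewrite divr_ge0// addr_ge0// mulr_ge0// powR_ge0.
lra.
Qed.

(** The average is at least 3/4 of mu I1 at s1 and at most 1/2 of it at s2. The quarter lost in
    between is charged to the energy by [smear_decay]. *)
Lemma energy_lower_bound (r kappa : R) : (0 < n)%N -> 0 < r -> 0 < kappa ->
  n%:R - 2 <= kappa ->
  exists s2 c C : R, [/\ 0 < s2, 0 < c, 0 < C &
  forall v x (mu L G : R), C2c v -> (forall y, r <= `|y| -> v y = 0) ->
    (forall y, 0 <= v y <= mu) -> v x = mu -> 0 < mu -> 0 < L ->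
    (forall y, - L <= laplacian v y) -> 0 < G ->
    LI (fun y => \sum_i partial i v y ^+ 2) <= G ->
    let s1 := Num.sqrt (c * mu / L) in
    s1 <= s2 /\ mu ^+ 2 * s1 `^ kappa <= C * G].
Proof.
move=> n0 r0 k0 nk.
have I10 : 0 < I1 := LI_dbump_gt0.
have I20 : 0 < I2 := LI_qbump_gt0.
have [V V0 HV] := @Cc_LI_small R n r r0.
(* Chosen so that s2 I1 = I1 + 8 V; since s2 >= 1 and n >= 1, the bound 4 s2^-n mu V of [smear_le]
   is then at most mu I1 / 2. *)
pose s2 := 1 + 8 * V / I1.
have s2V : 0 <= 8 * V / I1 by rewrite divr_ge0 ?mulr_ge0// ltW.
have s20 : 0 < s2 by rewrite ltr_wpDr.
pose A := (1 + @C_energy R n * s2 `^ (2 + 2 * (kappa / 2) - n%:R)) / 2.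
have CE0 : 0 <= @C_energy R n.
  by apply: LI_ge0 => y; apply: sumr_ge0 => i _; exact: sqr_ge0.
have A0 : 0 < A.
  by rewrite divr_gt0// ltr_wpDr// mulr_ge0// powR_ge0.
pose B := 8 * A / (I1 * kappa).
have B0 : 0 < B by rewrite divr_gt0// mulr_gt0.
(* The second constant makes the loss L I2 s1^2 / 2 equal to mu I1 / 4; the third comes from
   squaring an estimate by the root of G. *)
exists s2, (I1 / (2 * I2)), (B ^+ 2); split=> //.
- by rewrite divr_gt0// mulr_gt0.
- by rewrite exprn_gt0.
move=> v x mu L G C2 vr vmu vx mu0 L0 vL G0 vG s1.
have c0 : 0 < I1 / (2 * I2) * mu / L by rewrite !divr_gt0// mulr_gt0// divr_gt0// mulr_gt0.
have s10 : 0 < s1 by rewrite sqrtr_gt0.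
have s1E : s1 ^+ 2 = I1 / (2 * I2) * mu / L by rewrite sqr_sqrtr// ltW.
have F2 : smear v x s2 <= mu * I1 / 2.
  apply: le_trans (smear_le x s20 C2.1.1 HV vr vmu) _.
  have sn : s2 <= s2 ^+ n.
    by rewrite -[leLHS]expr1 ler_weXn2l// /s2 lerDl.
  have sn0 : 0 < s2 ^+ n by rewrite exprn_gt0.
  rewrite mulrCA ler_pdivrMl//.
  have h : 8 * V <= s2 * I1.
    have -> : s2 * I1 = I1 + 8 * V by rewrite /s2; field; rewrite gt_eqF.
    by rewrite lerDr ltW.
  have h2 : s2 * I1 <= s2 ^+ n * I1 by rewrite ler_pM2r.
  have h3 : 8 * V * mu <= s2 ^+ n * I1 * mu by rewrite ler_pM2r// (le_trans h).
  lra.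
have Fs s : 0 <= s -> s ^+ 2 <= s1 ^+ 2 -> mu * I1 * (3 / 4) <= smear v x s.
  move=> s0 ss; apply: le_trans (smear_ge x C2 s0 vL); rewrite vx.
  have -> : mu * I1 * (3 / 4) = mu * I1 - L * I2 * s1 ^+ 2 / 2.
    by rewrite s1E; field; rewrite !gt_eqF.
  by rewrite lerD2l lerN2 ler_pM2r ?invr_gt0// ler_wpM2l// mulr_ge0// ltW.
have mI : 0 < mu * I1 by rewrite mulr_gt0.
have s12 : s1 <= s2.
  (* Otherwise the average at s2 would be at least 3/4 and at most 1/2 of mu I1. *)
  rewrite leNgt; apply/negP => s21.
  have : mu * I1 * (3 / 4) <= smear v x s2.
    by apply: Fs; rewrite ?(ltW s20)// ler_sqr ?nnegrE ltW.
  lra.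
split=> //.
(* The decay estimate is used with k = kappa / 2, because the final squaring doubles the power of
   s1. *)
have k20 : 0 < kappa / 2 by rewrite divr_gt0.
have nk2 : n%:R <= 2 + 2 * (kappa / 2) by lra.
have := smear_decay x C2.1 G0 k20 nk2 vG s10 s12; rewrite -/A.
have := Fs s1 (ltW s10) (lexx _) => F1 F12.
have g0 : 0 < Num.sqrt G by rewrite sqrtr_gt0.
have gG : G = Num.sqrt G ^+ 2 by rewrite sqr_sqrtr// ltW.
have p0 : 0 < s1 `^ (kappa / 2) by rewrite powR_gt0.
have pE : s1 `^ kappa = s1 `^ (kappa / 2) ^+ 2.
  by rewrite -powR_mulrn ?powR_ge0// -powRrM divfK.
rewrite pE gG -!exprMn ler_sqr; last 2 first.
- by rewrite nnegrE mulr_ge0 ?powR_ge0// ltW.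
- by rewrite nnegrE mulr_ge0 ?sqrtr_ge0// ltW.

have : mu * I1 / 4 <= Num.sqrt G * A / (kappa / 2) * s1 `^ (- (kappa / 2)) by lra.
rewrite powRN ler_pdivlMr// => h.
have i4 : 0 < I1 / 4 by rewrite divr_gt0.
rewrite -(ler_pM2r i4).
rewrite (_ : mu * _ * _ = mu * I1 / 4 * s1 `^ (kappa / 2)); last by ring.
apply: le_trans h _.
by rewrite /B le_eqVlt; apply/orP; left; apply/eqP; field; rewrite !gt_eqF.
Qed.

End EnergyBound.

(** * Truncation of a solution near its maximum *)

Section ExtensionByZero.
Context {R : realType} {n : nat}.
Variables (Omega : set 'rV[R]_n) (u : 'rV[R]_n -> R) (c : R).
Hypotheses (oO : open Omega) (bO : bounded_set Omega) (c0 : 0 < c).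
Hypothesis uc : {within closure Omega, continuous u}.
Hypothesis ub : forall x, bdry Omega x -> u x = 0.
Implicit Types (g dg : 'rV[R]_n -> R) (x y e : 'rV[R]_n).

Definition ext0 g x : R := if `[< Omega x >] then g x else 0.

(** At a boundary point u vanishes and is continuous along the closure; any other outer point has a
    neighbourhood disjoint from Omega. Hence functions that vanish where u <= c extend by zero
    without loss of regularity. *)
Let near_out x : ~ Omega x -> \forall y \near x, Omega y -> u y < c.
Proof.
move=> Ox; have [cx|cx] := pselect (closure Omega x).
  have ux0 : u x = 0 by apply: ub; split=> //; rewrite (interior_id _).1.
  have /subspace_continuousP/(_ x cx)/cvgr_lt := uc.
  have uxc : u x < c by rewrite ux0.
  move=> /(_ _ uxc); rewrite near_withinE => H.
  near=> y => Oy; have : closure Omega y -> u y < c by near: y.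
  by apply; exact: subset_closure.
have : nbhs x (~` closure Omega).
  by apply: open_nbhs_nbhs; split=> //; exact/closed_openC/closed_closure.
by apply: filterS => y Cy Oy; case: Cy; exact: subset_closure.
Unshelve. all: by end_near. Qed.

Let ext0_out g x : (forall y, Omega y -> u y <= c -> g y = 0) -> ~ Omega x ->
  \forall y \near x, 0 = ext0 g y.
Proof.
move=> gc /near_out; apply: filterS => y Hy; rewrite /ext0.
by case: asboolP => // Oy; rewrite gc// ltW// Hy.
Qed.

Let ext0_in g x : Omega x -> \forall y \near x, g y = ext0 g y.
Proof.
move=> Ox; have : nbhs x Omega by exact: open_nbhs_nbhs.
by apply: filterS => y Oy; rewrite /ext0 asboolT.
Qed.

Lemma Cc_ext0 g : (forall x, Omega x -> {for x, continuous g}) ->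
  (forall y, Omega y -> u y <= c -> g y = 0) -> Cc (ext0 g).
Proof.
move=> cg gc; split=> [x|].
  rewrite /continuous_at; have [Ox|Ox] := pselect (Omega x).
    have -> : ext0 g x = g x by rewrite /ext0 asboolT.
    apply: cvg_trans (cg x Ox); apply: (@near_eq_cvg _ _ (nbhs x)).
    exact: ext0_in.
  have -> : ext0 g x = 0 by rewrite /ext0 asboolF.
  have C := @cst_continuous 'rV[R]_n R 0 x.
  apply: cvg_trans C; apply: (@near_eq_cvg _ _ (nbhs x)).
  exact: ext0_out.
have [M [_ OM]] := bO; exists (M + 1) => x Mx; rewrite /ext0.
case: asboolP => // Ox; have := OM (M + 1) _ x Ox; rewrite ltrDl ltr01 => /(_ isT).
by move=> /(lt_le_trans Mx); rewrite ltxx.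
Qed.

Lemma is_derive_ext0 g dg e x :
  (forall x, Omega x -> is_derive x e g (dg x)) ->
  (forall y, Omega y -> u y <= c -> g y = 0) ->
  is_derive x e (ext0 g) (ext0 dg x).
Proof.
move=> dgP gc; have [Ox|Ox] := pselect (Omega x).
  have -> : ext0 dg x = dg x by rewrite /ext0 asboolT.
  exact: (near_eq_is_derive (ext0_in g Ox) (dgP x Ox)).
have -> : ext0 dg x = 0 by rewrite /ext0 asboolF.
by apply: (near_eq_is_derive (ext0_out gc Ox)); exact: is_derive_cst.
Qed.

End ExtensionByZero.

Section Truncation.
Context {R : realType} {n : nat}.
Variables (Omega : set 'rV[R]_n) (u : 'rV[R]_n -> R) (m L : R).
Hypotheses (oO : open Omega) (bO : bounded_set Omega) (m0 : 0 < m) (L0 : 0 <= L).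
Hypothesis u2 : class_C 2 Omega u.
Hypothesis uc : {within closure Omega, continuous u}.
Hypothesis ub : forall x, bdry Omega x -> u x = 0.
Hypothesis um : forall x, Omega x -> 0 < u x <= m.
Hypothesis uL : forall x, Omega x -> - L <= laplacian u x.
Local Notation e_ i := (delta_mx 0 i : 'rV[R]_n).

Let c := m / 2.
Let w x := pospart (u x - c).
Let g0 x := w x ^+ 3.
(** [g1 i] and [g2 i] are the first and second derivatives of [g0] in direction i; like [g0], they
    vanish where u <= m / 2. *)
Let g1 i x := 3 * w x ^+ 2 * partial i u x.
Let g2 i x := 3 * (2 * w x * partial i u x * partial i u x + w x ^+ 2 * partial i (partial i u) x).

Definition truncation : 'rV[R]_n -> R := ext0 Omega (fun x => pospart (u x - m / 2) ^+ 3).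

Let c0 : 0 < c. Proof. by rewrite divr_gt0. Qed.

Let w0 x : u x <= c -> w x = 0.
Proof. by move=> ux; rewrite /w le0_pospart// subr_le0. Qed.

Let cw x : Omega x -> {for x, continuous w}.
Proof.
move=> Ox; apply: (@continuous_comp _ _ _ (fun x => u x - c) pospart); last exact: continuous_pospart.
by apply: continuousB; [exact: u2.1|exact: cst_continuous].
Qed.

Let du i x : Omega x -> is_derive x (e_ i) u (partial i u x).
Proof. by move=> Ox; apply: derivableP; exact: (u2.2 i).1. Qed.

Let duc i x : Omega x -> is_derive x (e_ i) (u - cst c) (partial i u x).
Proof.
move=> Ox; have D := du i Ox; have D2 := is_deriveB D (is_derive_cst c x (e_ i)).
by apply: is_derive_eq D2 _; rewrite subr0.
Qed.

Let dg0 i x : Omega x -> is_derive x (e_ i) g0 (g1 i x).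
Proof.
move=> Ox; have D1 := is_derive_pospart_cube (u x - c).
have D := is_derive_comp1 (f := u - cst c) D1 (duc i Ox).
exact: is_derive_eq D _.
Qed.

Let dg1 i x : Omega x -> is_derive x (e_ i) (g1 i) (g2 i x).
Proof.
move=> Ox; have D1 := is_derive_pospart_sqr (u x - c).
have D := is_derive_comp1 (f := u - cst c) D1 (duc i Ox).
have Du : is_derive x (e_ i) (partial i u) (partial i (partial i u) x).
  by apply: derivableP; exact: (((u2.2 i).2).2 i).1.
have D3 := is_deriveZ 3 (is_deriveM D Du).
have -> : g1 i = (3 : R) \*: (((fun z : R => pospart z ^+ 2) \o (u - cst c)) * partial i u).
  by apply/funext => y; rewrite /g1 -mulrA.
by apply: is_derive_eq D3 _; rewrite /GRing.scale /= /g2 /w; ring.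
Qed.

Let cg0 x : Omega x -> {for x, continuous g0}.
Proof.
move=> Ox; apply: (@continuous_comp _ _ _ w (fun t : R => t ^+ 3)); first exact: cw.
exact: exprn_continuous.
Qed.

Let cw2 x : Omega x -> {for x, continuous (fun y => w y ^+ 2)}.
Proof.
move=> Ox; apply: (@continuous_comp _ _ _ w (fun t : R => t ^+ 2)); first exact: cw.
exact: exprn_continuous.
Qed.

Let c3 x (k : R) : {for x, continuous (fun _ : 'rV[R]_n => k)}.
Proof. exact: cst_continuous. Qed.

Let cg1 i x : Omega x -> {for x, continuous (g1 i)}.
Proof.
move=> Ox; have cu : {for x, continuous (partial i u)} by exact: (u2.2 i).2.1.
exact: (continuousM (continuousM (@c3 x 3) (cw2 Ox)) cu).
Qed.

Let cg2 i x : Omega x -> {for x, continuous (g2 i)}.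
Proof.
move=> Ox; have cu : {for x, continuous (partial i u)} by exact: (u2.2 i).2.1.
have cuu : {for x, continuous (partial i (partial i u))}.
  exact: (((u2.2 i).2).2 i).2.1.
apply: (continuousM (@c3 x 3)).
apply: continuousD; last exact: (continuousM (cw2 Ox) cuu).
exact: (continuousM (continuousM (continuousM (@c3 x 2) (cw Ox)) cu) cu).
Qed.

Let g00 y : Omega y -> u y <= c -> g0 y = 0.
Proof. by move=> _ /w0 wy; rewrite /g0 wy expr0n. Qed.

Let g10 i y : Omega y -> u y <= c -> g1 i y = 0.
Proof. by move=> _ /w0 wy; rewrite /g1 wy expr0n/= mulr0 mul0r. Qed.

Let g20 i y : Omega y -> u y <= c -> g2 i y = 0.
Proof. by move=> _ /w0 wy; rewrite /g2 wy; ring. Qed.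

Let D1 i x : is_derive x (e_ i) truncation (ext0 Omega (g1 i) x).
Proof.
by apply: (is_derive_ext0 oO c0 uc ub) => // y Oy; exact: dg0.
Qed.

Let D2 i x : is_derive x (e_ i) (ext0 Omega (g1 i)) (ext0 Omega (g2 i) x).
Proof.
by apply: (is_derive_ext0 oO c0 uc ub (dg := g2 i)) => y Oy; [exact: dg1|exact: g10].
Qed.

Let P1 i : partial i truncation = ext0 Omega (g1 i).
Proof. by apply/funext => x; have [_ +] := D1 i x; exact. Qed.

Let P2 i : partial i (partial i truncation) = ext0 Omega (g2 i).
Proof. by rewrite P1; apply/funext => x; have [_ +] := D2 i x; exact. Qed.

Lemma C2c_truncation : C2c truncation.
Proof.
split; first split.
- by apply: (Cc_ext0 oO bO c0 uc ub) => // x Ox; exact: cg0.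
- move=> i; split=> [x|]; first by have [+ _] := D1 i x; exact.
  by rewrite P1; apply: (Cc_ext0 oO bO c0 uc ub) => y Oy; [exact: cg1|exact: g10].
move=> i; split=> [x|]; first by rewrite P1; have [+ _] := D2 i x; exact.
by rewrite P2; apply: (Cc_ext0 oO bO c0 uc ub) => y Oy; [exact: cg2|exact: g20].
Qed.

Let w_le x : Omega x -> 0 <= w x <= m / 2.
Proof.
move=> Ox; rewrite pospart_ge0 /= /w /pospart ge_max; apply/andP; split.
  by rewrite divr_ge0// ltW.
by have /andP[_ +] := um Ox; rewrite /c; lra.
Qed.

Lemma truncation_bounds x : 0 <= truncation x <= (m / 2) ^+ 3.
Proof.
rewrite /truncation /ext0; case: asboolP => [/w_le/andP[a b]|_].
  by rewrite exprn_ge0//= lerXn2r// nnegrE ?(le_trans a).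
by rewrite lexx/= exprn_ge0// divr_ge0// ltW.
Qed.

(** In Omega the Laplacian of w^3 is 3 w^2 Delta u + 6 w |grad u|^2. The last term is nonnegative,
    and 0 <= w <= m / 2. *)
Lemma laplacian_truncation_ge x :
  - (3 * (m / 2) ^+ 2 * L) <= laplacian truncation x.
Proof.
have B0 : 0 <= 3 * (m / 2) ^+ 2 * L by rewrite mulr_ge0// mulr_ge0// ?sqr_ge0.
rewrite /laplacian; under eq_bigr do rewrite P2.
rewrite /ext0; case: asboolP => [Ox|_]; last by rewrite big1// oppr_le0.
apply: (@le_trans _ _ (3 * w x ^+ 2 * laplacian u x)).
  have /andP[wx0 wxm] := w_le Ox.
  have h1 : w x ^+ 2 <= (m / 2) ^+ 2 by rewrite lerXn2r// nnegrE (le_trans wx0).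
  have h2 : 0 <= w x ^+ 2 by rewrite sqr_ge0.
  have h3 : w x ^+ 2 * L <= (m / 2) ^+ 2 * L by rewrite ler_wpM2r.
  have h4 : w x ^+ 2 * (- L) <= w x ^+ 2 * laplacian u x by rewrite ler_wpM2l// uL.
  lra.
rewrite /laplacian big_distrr /=; apply: ler_sum => i _.
have /andP[wx0 _] := w_le Ox.
have : 0 <= w x * (partial i u x) ^+ 2 by rewrite mulr_ge0// sqr_ge0.
by rewrite /g2; lra.
Qed.

Lemma gradient_truncation_le x : Omega x ->
  \sum_i partial i truncation x ^+ 2 <= 9 * (m / 2) ^+ 4 * \sum_i partial i u x ^+ 2.
Proof.
move=> Ox; rewrite big_distrr /=; apply: ler_sum => i _.
rewrite P1 /ext0 asboolT// /g1.
have -> : (3 * w x ^+ 2 * partial i u x) ^+ 2 = 9 * w x ^+ 4 * partial i u x ^+ 2 by ring.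
rewrite ler_wpM2r ?sqr_ge0//.
have /andP[wx0 wxm] := w_le Ox.
by rewrite ler_pM2l// lerXn2r// nnegrE (le_trans wx0).
Qed.

Lemma gradient_truncation_out x : ~ Omega x ->
  \sum_i partial i truncation x ^+ 2 = 0.
Proof.
by move=> Ox; rewrite big1// => i _; rewrite P1 /ext0 asboolF// expr0n.
Qed.

End Truncation.

(** * Comparison with the extended-real norm of the gradient *)

Section EnergyComparison.
Local Open Scope ereal_scope.

(* The integral of a nonnegative function is a supremum over simple functions
   below it, so that no measurability is required. *)
Lemma ge0_le_integral_nomeas d (T : measurableType d) (R : realType)
    (mu : {measure set T -> \bar R}) (f g : T -> \bar R) :
  (forall x, 0 <= f x) -> (forall x, f x <= g x) ->
  \int[mu]_x f x <= \int[mu]_x g x.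
Proof.
move=> f0 fg; have g0 x : 0 <= g x by exact: le_trans (fg x).
rewrite !ge0_integralTE//; apply: le_ereal_sup => _ [h /= hf <-].
by exists h => // x; exact: le_trans (fg x).
Qed.

(** The squared norm is the extended integral of |grad u|^2 cut off outside Omega; f / B lies below
    this integrand, and monotonicity asks for no measurability of it. *)
Lemma LI_le_L2norm_grad (R : realType) n (Omega : set 'rV[R]_n) (u f : 'rV[R]_n -> R)
    (B g : R) : Cc f -> (0 < B)%R -> (forall x, 0 <= f x)%R ->
  (forall x, Omega x -> f x <= B * \sum_i partial i u x ^+ 2)%R ->
  (forall x, ~ Omega x -> f x = 0%R) ->
  L2norm_grad Omega u = g%:E -> (LI f <= B * g ^+ 2)%R.
Proof.
move=> cf B0 f0 fB fO ug.
rewrite -ler_pdivrMl// -LIZ// -lee_fin EFin_LI; last exact: CcZ.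
have g0 : (0 <= g)%R by rewrite -lee_fin -ug; exact: Lnorm_ge0.
have -> : (g ^+ 2)%:E = L2norm_grad Omega u `^ 2.
  by rewrite ug poweR_EFin powR_mulrn.
rewrite /L2norm_grad poweR_Lnorm ?pnatr_eq0//.
apply: ge0_le_integral_nomeas => t.
  by rewrite lee_fin mulr_ge0// invr_ge0 ltW.
rewrite /patch; case: ifPn => [|/negP Ot].
  rewrite inE /= => Ot; rewrite /abse /= lee_fin ler_pdivrMl//.
  rewrite ger0_norm ?sqrtr_ge0// powR_mulrn ?sqrtr_ge0// sqr_sqrtr; last first.
    by apply: sumr_ge0 => i _; exact: sqr_ge0.
  apply: le_trans (fB _ Ot) _; rewrite ler_pM2l//.
  by apply: ler_sum => i _; rewrite mxE.
by rewrite fO ?mulr0 ?poweR_ge0// => Ot'; apply: Ot; rewrite inE.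
Qed.

End EnergyComparison.

(** * Conclusion *)

(** Raised to the power alpha, the energy estimate bounds M below by const m^(2 alpha) s1^(alpha
    kappa). Inserted in the definition of s1 this gives m^ga <= const s1^de with ga and de positive,
    and s1 <= s2. *)
Lemma sup_bound_of_energy (R : realType) (p alpha kappa c C A B s2 : R) :
  0 < alpha -> p < 2 * alpha + 1 -> alpha * kappa < 2 ->
  0 < c -> 0 < C -> 0 < A -> 0 < B -> 0 < s2 ->
  exists2 K : R, 0 < K & forall m g M : R, 0 < m -> 0 < g ->
    B * g `^ (2 * alpha) <= M ->
    let s1 := Num.sqrt (c * (m * M) / (A * m `^ p)) in
    s1 <= s2 -> m ^+ 2 * s1 `^ kappa <= C * g ^+ 2 -> m <= K.
Proof.
move=> a0 pa ak c0 C0 A0 B0 s20.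
pose ga := 2 * alpha + 1 - p; pose de := 2 - kappa * alpha.
have ga0 : 0 < ga by rewrite subr_gt0.
have de0 : 0 < de by rewrite subr_gt0 mulrC.
(* This bounds m^ga; the bound on m is its power with exponent 1 / ga. *)
pose K := A * C `^ alpha * s2 `^ de / (c * B).
have K0 : 0 < K by rewrite divr_gt0 ?mulr_gt0// powR_gt0.
exists (K `^ ga^-1); first exact: powR_gt0.
move=> m g M m0 g0 gM s1 s12 mg.
have M0 : 0 < M by apply: lt_le_trans gM; rewrite mulr_gt0// powR_gt0.
have mp0 : 0 < m `^ p by rewrite powR_gt0.
have q0 : 0 < c * (m * M) / (A * m `^ p) by rewrite divr_gt0// !mulr_gt0.
have s10 : 0 < s1 by rewrite sqrtr_gt0.
have s1E : s1 ^+ 2 * (A * m `^ p) = c * (m * M).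
  by rewrite sqr_sqrtr ?ltW// divfK// gt_eqF// mulr_gt0.
have h1 : m `^ (2 * alpha) * s1 `^ (kappa * alpha) <= C `^ alpha * g `^ (2 * alpha).
  rewrite !(powRrM _ _ alpha) (powR_mulrn 2) ?(ltW m0)// (powR_mulrn 2) ?(ltW g0)//.
  rewrite -!powRM ?powR_ge0 ?sqr_ge0 ?(ltW C0)//.
  apply: ge0_ler_powR => //; first exact: ltW.
    by rewrite nnegrE mulr_ge0 ?powR_ge0// sqr_ge0.
  by rewrite nnegrE mulr_ge0 ?(ltW C0)// sqr_ge0.
have s1D : s1 ^+ 2 = s1 `^ de * s1 `^ (kappa * alpha).
  rewrite -powR_mulrn ?ltW// -powRD ?(gt_eqF s10) ?implybT//.
  by rewrite /de subrK.
have mD : m * m `^ (2 * alpha) = m `^ ga * m `^ p.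
  rewrite -[X in X * _](powRr1 (ltW m0)) -!powRD ?(gt_eqF m0) ?implybT//.
  by rewrite /ga; congr (_ `^ _); ring.
have sk0 : 0 < s1 `^ (kappa * alpha) by rewrite powR_gt0.
have Ca0 : 0 < C `^ alpha by rewrite powR_gt0.
have h2 : s1 `^ de <= s2 `^ de.
  by apply: ge0_ler_powR => //; rewrite ?nnegrE ltW.
have h3 : c * B * m `^ ga <= A * C `^ alpha * s1 `^ de.
  (* After multiplication by m^p s1^(kappa alpha) the definition of s1 turns the right side into
     C^alpha c m M. *)
  rewrite -(ler_pM2r mp0) -(ler_pM2r sk0).
  have -> : A * C `^ alpha * s1 `^ de * m `^ p * s1 `^ (kappa * alpha)
    = C `^ alpha * (c * (m * M)) by rewrite -s1E s1D; ring.
  have -> : c * B * m `^ ga * m `^ p * s1 `^ (kappa * alpha) =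
    c * B * m * (m `^ (2 * alpha) * s1 `^ (kappa * alpha)).
    by rewrite -[LHS]mulrA -(mulrA (c * B)) [m `^ ga * _]mulrA -mD; ring.
  apply: (@le_trans _ _ (c * B * m * (C `^ alpha * g `^ (2 * alpha)))).
    by rewrite ler_pM2l// !mulr_gt0.
  have -> : c * B * m * (C `^ alpha * g `^ (2 * alpha)) =
    C `^ alpha * (c * (m * (B * g `^ (2 * alpha)))) by ring.
  by rewrite !ler_pM2l.
have h4 : m `^ ga <= K.
  rewrite /K ler_pdivlMr ?mulr_gt0// mulrC (le_trans h3)// ler_pM2l// mulr_gt0//.
have -> : m = (m `^ ga) `^ ga^-1 by rewrite -powRrM divff ?gt_eqF// powRr1 ?ltW.
by apply: ge0_ler_powR => //; rewrite ?nnegrE ?powR_ge0 ?invr_ge0 ?ltW.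
Qed.

(** For N >= 3 the growth condition says exactly that alpha (N - 2) < 2, which is trivial for N <=
    2; the strict inequality leaves room for kappa. *)
Lemma exists_subcritical_exponent (R : realType) (N : nat) (alpha : R) : 0 < alpha ->
  ((2 * alpha + 1)%:E < crit_exponent R N)%E ->
  exists kappa : R, [/\ 0 < kappa, N%:R - 2 <= kappa & alpha * kappa < 2].
Proof.
move=> a0 hc.
have aN : alpha * (N%:R - 2) < 2.
  move: hc; rewrite /crit_exponent; case: leqP => [N2 _|N2].
    have : N%:R <= 2 :> R by rewrite ler_nat.
    by move=> N2'; apply: (@le_lt_trans _ _ 0) => //; rewrite pmulr_rle0// subr_le0.
  have N20 : 0 < N%:R - 2 :> R by rewrite subr_gt0 ltr_nat.
  rewrite lte_fin ltr_pdivlMr//; nra.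
have ia : alpha * (2 / alpha) = 2 by field; rewrite gt_eqF.
have i0 : 0 < 2 / alpha by rewrite divr_gt0.
have aN' : N%:R - 2 < 2 / alpha by rewrite -(ltr_pM2l a0) ia.
(* The value 1 / alpha keeps kappa positive when N - 2 is not, and its product with alpha is 1 <
   2. *)
exists (Num.max (N%:R - 2) (alpha^-1)).
rewrite lt_max invr_gt0 a0 orbT le_max lexx; split=> //.
rewrite maxr_pMr ?ltW// gt_max aN divff ?gt_eqF// ltr1n//.
Qed.

(** * Finiteness of the nonlocal coefficient *)

Section Equation.
Context {R : realType} {N : nat}.
Implicit Types (u : 'rV[R]_N -> R).

(** If the norm were infinite, the left member at a point of Omega would be +oo, -oo or 0, according
    to the sign of - Delta u, whereas the right member is a positive real. *)
Lemma kirchhoff_coefficient (Omega : set 'rV[R]_N) (a b alpha p t : R) h u :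
  0 < a -> 0 < b -> 0 < alpha -> 0 < t -> Omega !=set0 ->
  (forall x s xi, closure Omega x -> 0 < s -> 0 <= h x s xi) ->
  kirchhoff_solution Omega a b alpha p h t u ->
  exists2 g : R, 0 <= g & L2norm_grad Omega u = g%:E /\
    forall x, Omega x ->
      (a + t * b * g `^ (2 * alpha)) * - laplacian u x =
      u x `^ p + t * h x (u x) (grad u x).
Proof.
move=> a0 b0 al0 t0 [x0 Ox0] h0 [_ _ eqn upos _].
have g0 : (0 <= L2norm_grad Omega u)%E by exact: Lnorm_ge0.
case E : (L2norm_grad Omega u) g0 => [g| |] g0.
- exists g; first by rewrite -lee_fin.
  split=> // x Ox; have := eqn x Ox.
  by rewrite E poweR_EFin => H; apply/EFin_inj; rewrite -H !EFinM EFinD !EFinM.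
- exfalso; have := eqn x0 Ox0; rewrite E.
  have tb : 0 < t * b by rewrite mulr_gt0.
  have ap : 2 * alpha != 0 by rewrite gt_eqF// mulr_gt0.
  rewrite poweRyr// gt0_muley ?lte_fin// addey//.
  have rhs : 0 < u x0 `^ p + t * h x0 (u x0) (grad u x0).
    rewrite ltr_pwDl ?powR_gt0 ?upos// mulr_ge0 ?(ltW t0)// h0 ?upos//.
    exact: subset_closure.
  have [l0|l0|l0] := ltgtP 0 (- laplacian u x0).
  + by rewrite gt0_mulye// lte_fin.
  + by rewrite lt0_mulye// lte_fin.
  + by rewrite -l0 mule0 => -[] e; rewrite -e ltxx in rhs.
- by move: g0; rewrite leeNy_eq.
Qed.

End Equation.

Unset Implicit Arguments.
Set Strict Implicit.
Set Printing Implicit Defensive.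

Theorem theorem3p9 (R : realType) (N : nat) (hN : (2 <= N)%N)
  (Omega : set 'rV[R]_N) (hOmega : bounded_smooth_domain Omega)
  (a b alpha p : R) (ha : 0 < a) (hb : 0 < b) (halpha : 0 < alpha)
  (hp1 : 1 < p) (hpalpha : p < 2 * alpha + 1)
  (hcrit : ((2 * alpha + 1)%:E < crit_exponent R N)%E)
  (h : 'rV[R]_N -> R -> 'rV[R]_N -> R)
  (hholder : locally_holder
     [set z : 'rV[R]_N * R * 'rV[R]_N | closure Omega z.1.1 /\ 0 < z.1.2]
     (fun z => h z.1.1 z.1.2 z.2))
  (hge0 : forall (x : 'rV[R]_N) (s : R) (xi : 'rV[R]_N),
       closure Omega x -> 0 < s -> 0 <= h x s xi)
  (lambda : R) (hlambda : 0 < lambda)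
  (hlim : forall eps : R, 0 < eps -> exists2 delta : R, 0 < delta &
     forall (x : 'rV[R]_N) (s : R) (xi : 'rV[R]_N),
       closure Omega x -> 0 < s < delta ->
       `|h x s xi / s - lambda| < eps)
  (hgrowth : exists C q : R, [/\ 0 < C, 1 < q, q < p &
     forall (x : 'rV[R]_N) (s : R) (xi : 'rV[R]_N),
       closure Omega x -> 0 < s ->
       `|h x s xi| <= C * (s + s `^ q)])
  (hlambda1 : lambda < a * lambda1 Omega)
  (t0 : R) (ht0 : 0 < t0 <= 1) :
  exists2 R0 : R, 0 < R0 &
    forall (t : R) (u : 'rV[R]_N -> R), t0 <= t <= 1 ->
      kirchhoff_solution Omega a b alpha p h t u ->
      (supnorm Omega u <= R0%:E)%E.
Proof.
have [oO _ neO bO _] := hOmega.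
have [C0 [q [C00 q1 qp hC]]] := hgrowth.
have /andP[t00 _] := ht0.
have n0 : (0 < N)%N by exact: leq_trans hN.
have [kappa [k0 Nk ak]] := exists_subcritical_exponent halpha hcrit.
have [D D0 OD] : exists2 D : R, 0 < D & forall x, Omega x -> `|x| < D.
  have [M M0 HM] := ex_strict_bound_gt0 bO; exists M => // x Ox; exact: HM.
have [s2 [c [C [s20 c0 CC0 core]]]] := energy_lower_bound n0 D0 k0 Nk.
(* When m > 1, each of u, u^q and u^p is at most m^p, since 1 < q < p; hence A m^p dominates the
   right member of the equation. *)
pose A := 1 + 2 * C0.
have A0 : 0 < A by rewrite addr_gt0// mulr_gt0.
(* The truncation has maximum (m/2)^3, Laplacian at least -3 (m/2)^2 L and energy at most 9 (m/2)^4
   g^2. The first two have ratio m / (6 L); division of the energy estimate by (m/2)^4 / 4 gives m^2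
   on the left and the constant 36 C on the right. *)
have c'0 : 0 < c / 6 by rewrite divr_gt0.
have C'0 : 0 < 36 * C by rewrite mulr_gt0.
(* For t >= t0 the coefficient M is at least t0 b g^(2 alpha); the bound depends on t0 through this
   constant. *)
have B'0 : 0 < t0 * b by rewrite mulr_gt0.
have [K K0 HK] := sup_bound_of_energy halpha hpalpha ak c'0 C'0 A0 B'0 s20.
(* The summand 1 covers the case m <= 1. *)
exists (1 + K) => [|t u /andP[tt0 tt1] sol]; first by rewrite addr_gt0.
have t0' : 0 < t by exact: lt_le_trans tt0.
have [u2 uc _ upos ub] := sol.
have [g g0 [ug eqn]] := kirchhoff_coefficient ha hb halpha t0' neO hge0 sol.
have cO : compact (closure Omega).
  apply: bounded_closed_compact; last exact: closed_closure.
  exists D; split; rewrite ?num_real// => M DM x cx.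
  have : closure [set y : 'rV[R]_N | `|y| <= D] x.
    by apply: closure_subset cx => y /OD/ltW.
  have clD : closed [set y : 'rV[R]_N | `|y| <= D].
    apply: (@closed_comp _ _ (fun x : 'rV[R]_N => `|x|) [set z | z <= D]) => [y _|].
      exact: norm_continuous.
    exact: closed_le.
  by move/closure_id : clD => <- /= /le_trans; apply; exact: ltW.
have neC : closure Omega !=set0.
  by case: neO => x Ox; exists x; exact: subset_closure.
have [x0 /[!inE] cx0 umax] := compact_EVT_max neC cO uc.
set m := u x0.
have um x : Omega x -> 0 < u x <= m.
  by move=> Ox; rewrite upos// umax// inE; exact: subset_closure.
have m0 : 0 < m by case: neO => x /um/andP[]; exact: lt_le_trans.
suff mK : m <= 1 + K.
  apply: ub_ereal_sup => _ [x Ox <-]; rewrite lee_fin.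
  by have /andP[ux0 uxm] := um x Ox; rewrite gtr0_norm// (le_trans uxm).
(* The maximum is positive and u vanishes on the boundary, so it is attained inside. *)
have Ox0 : Omega x0.
  apply: contrapT => nO; have : u x0 = 0.
    by apply: ub; split=> //; rewrite (interior_id _).1.
  by move=> e; move: m0; rewrite /m e ltxx.
have [m1|m1] := leP m 1; first by rewrite (le_trans m1)// lerDl ltW.
apply: (@le_trans _ _ K); last by rewrite lerDr.
pose M := a + t * b * g `^ (2 * alpha).
have M0 : 0 < M.
  by apply: ltr_wpDr => //; rewrite mulr_ge0 ?powR_ge0// mulr_ge0// ltW.
pose L := A * m `^ p / M.
have L0 : 0 < L by rewrite divr_gt0// mulr_gt0// powR_gt0.
have uL x : Omega x -> - L <= laplacian u x.
  move=> Ox; have /andP[ux0 uxm] := um x Ox.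
  rewrite lerNl /L ler_pdivlMr// mulrC eqn//.
  have pw s : 0 <= s -> s <= p -> u x `^ s <= m `^ p.
    move=> s0 sp; apply: (@le_trans _ _ (m `^ s)).
      by apply: ge0_ler_powR => //; rewrite nnegrE ltW.
    by apply: ler_powR => //; exact: ltW.
  have h0 := hge0 x (u x) (grad u x) (subset_closure Ox) ux0.
  have := hC x (u x) (grad u x) (subset_closure Ox) ux0.
  rewrite ger0_norm// => hh.
  have e1 := pw p (ltW (lt_trans ltr01 hp1)) (lexx _).
  have e2 := pw q (ltW (lt_trans ltr01 q1)) (ltW qp).
  have e3 : u x <= m `^ p.
    by have := pw 1 ler01 (ltW hp1); rewrite powRr1// ltW.
  have e4 : t * h x (u x) (grad u x) <= h x (u x) (grad u x) by rewrite ler_piMl.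
  have e5 : C0 * (u x + u x `^ q) <= C0 * (m `^ p + m `^ p).
    by rewrite ler_wpM2l ?(ltW C00)// lerD.
  rewrite /A; lra.
have C2 := C2c_truncation oO bO m0 u2 uc ub.
pose v := truncation Omega u m.
have vD y : D <= `|y| -> v y = 0.
  move=> Dy; rewrite /v /truncation /ext0; case: asboolP => // /OD.
  by rewrite ltNge Dy.
have vx0 : v x0 = (m / 2) ^+ 3.
  rewrite /v /truncation /ext0 asboolT// -/m ge0_pospart; first by congr (_ ^+ 3); lra.
  lra.
have vb := truncation_bounds m0 um.
have vL := laplacian_truncation_ge oO m0 (ltW L0) u2 uc ub um uL.
have m20 : 0 < m / 2 by rewrite divr_gt0.
have m30 : 0 < (m / 2) ^+ 3 by rewrite exprn_gt0.
have L30 : 0 < 3 * (m / 2) ^+ 2 * L.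
  by apply: mulr_gt0 => //; apply: mulr_gt0 => //; exact: exprn_gt0.
have B0 : 0 < 9 * (m / 2) ^+ 4 by apply: mulr_gt0 => //; exact: exprn_gt0.
pose f y := \sum_i partial i v y ^+ 2.
have vG : LI f <= 9 * (m / 2) ^+ 4 * g ^+ 2.
  apply: (LI_le_L2norm_grad (Omega := Omega) (u := u)) => //.
  - exact: (Cc_LI_sum (index_enum 'I_N) (fun i => Cc_sqr (C2.1.2 i).2)).1.
  - by move=> y; apply: sumr_ge0 => i _; exact: sqr_ge0.
  - by move=> y; exact: (gradient_truncation_le oO m0 u2 uc ub um).
  - by move=> y; exact: (gradient_truncation_out oO m0 u2 uc ub).
(* G stays free: a suitable small value excludes g = 0, and then the actual energy bound is
   inserted. *)
have CORE G := core v x0 ((m / 2) ^+ 3) (3 * (m / 2) ^+ 2 * L) G C2 vD vb vx0 m30 L30 vL.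
pose s1 := Num.sqrt (c / 6 * (m * M) / (A * m `^ p)).
have s1E : Num.sqrt (c * (m / 2) ^+ 3 / (3 * (m / 2) ^+ 2 * L)) = s1.
  congr Num.sqrt; rewrite /L; field.
  by rewrite !gt_eqF// powR_gt0.
rewrite s1E in CORE.
have s10 : 0 < s1.
  by rewrite sqrtr_gt0 divr_gt0 ?mulr_gt0// powR_gt0.
have E0 : 0 < ((m / 2) ^+ 3) ^+ 2 * s1 `^ kappa.
  by apply: mulr_gt0; [exact: exprn_gt0|exact: powR_gt0].
have g1 : 0 < g.
  (* If g = 0, the energy of v is below every positive G. With E the left member of the estimate, G
     = E / (2 C) would give E <= E / 2, although E > 0. *)
  rewrite lt_neqAle g0 andbT; apply/negP => /eqP ge0.
  have d0 : 0 < ((m / 2) ^+ 3) ^+ 2 * s1 `^ kappa / (2 * C).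
    by rewrite divr_gt0// mulr_gt0.
  have [|_] := CORE _ d0.
    by apply: le_trans vG _; rewrite -ge0 expr0n/= mulr0 ltW.
  rewrite leNgt => /negP; apply.
  rewrite (_ : C * _ = ((m / 2) ^+ 3) ^+ 2 * s1 `^ kappa / 2); first lra.
  by field; rewrite gt_eqF.
have G0 : 0 < 9 * (m / 2) ^+ 4 * g ^+ 2 by apply: mulr_gt0 => //; exact: exprn_gt0.
have [s12 mg] := CORE _ G0 vG.
apply: (HK m g M) => //.
  apply: (@le_trans _ _ (t * b * g `^ (2 * alpha))); last by rewrite lerDr ltW.
  by rewrite ler_wpM2r ?powR_ge0// ler_pM2r.
have m40 : 0 < (m / 2) ^+ 4 / 4 by apply: divr_gt0 => //; exact: exprn_gt0.
rewrite -(ler_pM2l m40) -/s1.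
have -> : (m / 2) ^+ 4 / 4 * (m ^+ 2 * s1 `^ kappa) = ((m / 2) ^+ 3) ^+ 2 * s1 `^ kappa.
  by field.
apply: le_trans mg _; rewrite le_eqVlt; apply/orP; left; apply/eqP; by field.
Qed.
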